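(* Let $u\le v\le w$ in $S_k$ (Bruhat order) and define $$\mathcal{U}_{u,v,w}:=\{\mathcal{F}\in R(u,w)\mid \mathcal{F}\xrightarrow{w_0}\mathcal{F}(vw_0)\}.$$ Then $\mathcal{U}_{u,v,w}$ is a principal open subset of $R(u,w)$ (the non-vanishing locus of a single regular function), and there is an isomorphism of algebraic varieties $$\mathcal{U}_{u,v,w}\cong R(u,v)\times R(v,w).$$
   Context: $S_k$ is the symmetric group, $w_0$ its longest element. For $w\in S_k$ the coordinate flag $\mathcal{F}(w)$ in $\mathbb{C}^k$ has $j$-th subspace spanned by $e_{w(1)},\dots,e_{w(j)}$; $\mathcal{F}^{\mathrm{std}}=\mathcal{F}(e)$ and $\mathcal{F}^{\mathrm{ant}}=\mathcal{F}(w_0)$. For complete flags $\mathcal{F},\mathcal{F}'$ in $\mathbb{C}^k$ write $\mathcal{F}\xrightarrow{w}\mathcal{F}'$ if there is $g\in\mathrm{GL}(k)$ with $g\mathcal{F}=\mathcal{F}^{\mathrm{std}}$ and $g\mathcal{F}'=\mathcal{F}(w)$. For $v\le w$, the open Richardson variety is $$R(v,w)=\{\mathcal{F}\in\mathrm{Fl}_k\mid \mathcal{F}^{\mathrm{std}}\xrightarrow{w}\mathcal{F}\xrightarrow{v^{-1}w_0}\mathcal{F}^{\mathrm{ant}}\},$$ a smooth affine variety of dimension $\ell(w)-\ell(v)$, where $\mathrm{Fl}_k$ is the variety of complete flags in $\mathbb{C}^k$. *)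

(* Defs.v *)
From HB Require Import structures.
From mathcomp Require Import all_boot all_order all_algebra all_fingroup.
From mathcomp Require Import classical_sets reals.
From mathcomp Require Export complex mpoly.

Set Implicit Arguments.
Unset Strict Implicit.
Unset Printing Implicit Defensive.

Import GRing.Theory.
Local Open Scope ring_scope.
Local Open Scope classical_set_scope.

(** * Subvarieties of products of projective spaces

    A [projSpace K] is a type of points embedded in a finite product of
    projective spaces over [K]: a coordinate [j] is a homogeneous coordinate on
    the factor [pfactor j], and [hcoord x] picks representatives of the
    homogeneous coordinates of [x].  Everything below only involves
    multihomogeneous polynomials, so that it does not depend on the choice of
    representatives. *)

Record projSpace (K : fieldType) := ProjSpace {
  point :> Type;
  pindex : finType;
  pcoord : finType;
  pfactor : pcoord -> pindex;
  hcoord : point -> pcoord -> K }.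

Section ProjectiveVarieties.
Variable K : fieldType.
Implicit Types V W : projSpace K.

Definition hpoly V := {mpoly K[#|pcoord V|]}.

Definition heval V (P : hpoly V) (x : V) : K :=
  P.@[fun n => hcoord x (enum_val n)].

Definition multihomog V (d : pindex V -> nat) (P : hpoly V) : Prop :=
  forall m, m \in msupp P -> forall i,
    (\sum_(j | pfactor j == i) m (enum_rank j))%N = d i.

Definition zclosed V (Z : set V) : Prop :=
  exists S : set (hpoly V),
    (forall P, S P -> exists d, multihomog d P) /\
    Z = [set x | forall P, S P -> heval P x = 0].

Definition zopen V (U : set V) : Prop := zclosed (~` U).

(** Only the values of [f] on [X] matter. *)
Definition regular V (X : set V) (f : V -> K) : Prop :=
  forall x, X x -> exists U : set V,
    [/\ zopen U, U x &
      exists d P Q, [/\ multihomog d P, multihomog d Q &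
        forall y, X y -> U y -> heval Q y != 0 /\ f y = heval P y / heval Q y]].

Definition principal_open V (X U : set V) : Prop :=
  exists f : V -> K, regular X f /\ U = [set x | X x /\ f x != 0].

(** Only the values of [phi] on [X] matter. *)
Definition morphism_on V W (X : set V) (Y : set W) (phi : V -> W) : Prop :=
  [/\ forall x, X x -> Y (phi x),
      forall U : set W, zopen U ->
        exists2 U' : set V, zopen U' & X `&` phi @^-1` U = X `&` U' &
      forall (U : set W) (f : W -> K), zopen U -> regular (Y `&` U) f ->
        regular (X `&` phi @^-1` U) (f \o phi)].

Definition isomorphic V W (X : set V) (Y : set W) : Prop :=
  exists (phi : V -> W) (psi : W -> V),
    [/\ morphism_on X Y phi, morphism_on Y X psi,
        forall x, X x -> psi (phi x) = x &
        forall y, Y y -> phi (psi y) = y].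

Definition prodSpace V W : projSpace K :=
  @ProjSpace K (V * W)%type (pindex V + pindex W)%type (pcoord V + pcoord W)%type
    (fun j => match j with
              | inl a => inl (pfactor a)
              | inr b => inr (pfactor b)
              end)
    (fun x j => match j with
                | inl a => hcoord x.1 a
                | inr b => hcoord x.2 b
                end).

End ProjectiveVarieties.

(** * The symmetric group

    In [{perm T}], [(s * t)%g] is the permutation [x |-> t (s x)], i.e. the
    product [t s] in the functional convention. *)

Section SymmetricGroup.
Variable k : nat.
Implicit Types u v w : 'S_k.

Definition longest : 'S_k := perm (@rev_ord_inj k).

Definition perm_length w : nat :=
  #|[pred p : 'I_k * 'I_k | (p.1 < p.2)%N && (w p.2 < w p.1)%N]|.

Definition bruhat_step u v : bool :=
  [exists i, exists j, v == (tperm i j * u)%g] &&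
  (perm_length u < perm_length v)%N.

(** [connect] is the reflexive transitive closure. *)
Definition bruhat : rel 'S_k := connect bruhat_step.

End SymmetricGroup.

(** * Complete flags *)

Section Flags.
Variables (K : fieldType) (k : nat).

Definition is_flag (F : {ffun 'I_k.+1 -> {vspace 'cV[K]_k}}) : bool :=
  [forall j : 'I_k.+1, \dim (F j) == j] &&
  [forall i : 'I_k.+1, forall j : 'I_k.+1, (i <= j)%N ==> (F i <= F j)%VS].

Record flag := Flag {
  flagval :> {ffun 'I_k.+1 -> {vspace 'cV[K]_k}};
  _ : is_flag flagval }.

HB.instance Definition _ := [isSub for flagval].
HB.instance Definition _ := [Choice of flag by <:].

Definition coord_seq (w : 'S_k) (j : nat) : seq 'cV[K]_k :=
  [seq delta_mx (w i) 0 | i : 'I_k <- enum 'I_k & (i < j)%N].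

Definition coord_fun (w : 'S_k) : {ffun 'I_k.+1 -> {vspace 'cV[K]_k}} :=
  [ffun j : 'I_k.+1 => <<coord_seq w j>>%VS].

Lemma coord_seq_full_basis (w : 'S_k) :
  basis_of fullv [seq delta_mx (w i) 0 : 'cV[K]_k | i <- enum 'I_k].
Proof.
rewrite basisEdim size_map size_enum_ord dimvf /dim /= muln1 leqnn andbT.
apply/subvP => x _; rewrite (matrix_sum_delta x) memv_suml // => i _.
rewrite big_ord1 memvZ // memv_span //; apply/mapP.
by exists ((w^-1)%g i); rewrite ?mem_enum ?permKV.
Qed.

Lemma coord_fun_is_flag (w : 'S_k) : is_flag (coord_fun w).
Proof.
apply/andP; split; apply/forallP => i; last first.
  apply/forallP => j; apply/implyP => le_ij; rewrite !ffunE; apply: sub_span.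
  move=> x /mapP[a]; rewrite mem_filter => /andP[lt_ai _] ->.
  apply/mapP; exists a => //; rewrite mem_filter mem_enum andbT.
  exact: leq_trans lt_ai le_ij.
rewrite ffunE /coord_seq.
have frs : free (coord_seq w i).
  pose rest := [seq delta_mx (w a) 0 : 'cV[K]_k | a : 'I_k <- enum 'I_k & ~~ (a < i)%N].
  apply: (@catl_free _ _ rest); rewrite -map_cat.
  rewrite (perm_free (perm_map _ (permEl (perm_filterC _ _)))).
  exact: basis_free (coord_seq_full_basis w).
move: frs; rewrite /free => /eqP ->; rewrite size_map.
rewrite -(size_map val) -(@filter_map _ _ val (fun n => n < i)%N) val_enum_ord.
rewrite -[X in filter _ (iota 0 X)](@subnKC i k) -1?ltnS // iotaD filter_cat.
rewrite (_ : filter _ (iota 0 i) = iota 0 i); last first.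
  by apply/all_filterP/allP => n; rewrite mem_iota.
rewrite (_ : filter _ _ = [::]) ?cats0 ?size_iota //.
apply/eqP; rewrite -[_ == _]negbK -has_filter; apply/hasPn => n.
by rewrite mem_iota -leqNgt => /andP[].
Qed.

Definition coord_flag (w : 'S_k) : flag := Flag (coord_fun_is_flag w).

Definition std_flag : flag := coord_flag 1%g.
Definition ant_flag : flag := coord_flag (longest k).

Definition maps_flag (g : 'M[K]_k) (F F' : flag) : Prop :=
  forall j, (linfun (mulmx g) @: F j)%VS = F' j.

Definition rel_pos (w : 'S_k) (F F' : flag) : Prop :=
  exists2 g : 'M[K]_k, g \in unitmx &
    maps_flag g F std_flag /\ maps_flag g F' (coord_flag w).

(** Plücker coordinates: the coordinate indexed by [A] is the minor, on the
    rows in [A], of a basis of the [#|A|]-th subspace. *)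
Definition plucker (F : flag) (A : {set 'I_k}) : K :=
  \det (\matrix_(i < #|A|, j < #|A|)
          (nth 0 (vbasis (F (inord #|A|))) j) (enum_val i) 0).

Definition flagSpace : projSpace K :=
  @ProjSpace K flag 'I_k.+1 {set 'I_k} (fun A => inord #|A|) plucker.

(** [(longest * v^-1)%g] is the permutation v^{-1} w_0 and [(longest * v)%g] is
    the permutation v w_0 of the functional convention. *)
Definition richardson (v w : 'S_k) : set flagSpace :=
  [set F : flag | rel_pos w std_flag F /\
                  rel_pos (longest k * v^-1)%g F ant_flag].

Definition richardson_chart (u v w : 'S_k) : set flagSpace :=
  [set F : flag | richardson u w F /\
                  rel_pos (longest k) F (coord_flag (longest k * v)%g)].

Definition richardson_prod (u v w : 'S_k) :
    set (prodSpace flagSpace flagSpace) :=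
  [set F | richardson u v F.1 /\ richardson v w F.2].

End Flags.

Arguments richardson K {k} v w.
Arguments richardson_chart K {k} u v w.
Arguments richardson_prod K {k} u v w.

(* Main.v *)
From mathcomp Require Import all_boot all_order all_algebra all_fingroup.
From mathcomp Require Import zify ring.
From mathcomp Require Import boolp classical_sets reals complex.
Require Import Defs.

(** Write [V] for the permutation matrix of [v], and let [N] be the conjugate by
    [V] of the group of lower unitriangular matrices.  A flag [F] is in general
    position with the coordinate flag of [v w0] exactly when [F = x V F_std] for
    some [x] in [N], which is then unique ([chart_param],
    [normal_form_flag_of]).  This happens exactly when the Plücker coordinates
    of [F] at the sets [v {0, ..., j}] are all non-zero ([chart_flagP]); on
    [R(u, w)] those at the sets [w {0, ..., j}] never vanish, so that the product
    of the quotients is a regular function defining the chart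
    ([chart_principal]).

    The isomorphism is the Kazhdan-Lusztig splitting.  Let [N+] and [N-] be the
    subgroups of upper and of lower triangular matrices of [N].  Every [x] in
    [N] has unique factorizations [x = n+ n- = m- m+], with [n+], [m+] in [N+]
    and [n-], [m-] in [N-] ([residue_uni], [residue_unique]).  Left
    multiplication by an upper triangular matrix preserves the Schubert cell of
    [w], and by a lower triangular one the opposite cell of [u].  Hence
    [x V F_std] lies in [R(u, w)] iff [n- V F_std] lies in the cell of [w] and
    [m+ V F_std] in the opposite cell of [u], that is, iff
    [m+ V F_std] is in [R(u, v)] and [n- V F_std] is in [R(v, w)], because [N+ V]
    and [N- V] parametrize the cell and the opposite cell of [v]
    ([richardson_lower_param], [richardson_upper_param]).  Finally [m+] and
    [n-] determine [x]: since [m+ n-^-1 = m-^-1 n+], the matrix [n+] is the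
    [N+]-factor of [m+ n-^-1], and [x = n+ n-] ([glue_mx]).

    Everything is given by explicit formulas.  The entries of [x] are quotients
    of Plücker coordinates ([normal_form]), the factors of [x] are obtained by
    solving linear systems with invertible matrices ([eliminator]), and the
    Plücker coordinates of the resulting flags are minors, up to one scalar per
    degree ([plucker_flag_of]).  Hence both maps are given in homogeneous
    coordinates by quotients of multihomogeneous polynomials, and
    [morphism_criterion] shows that they are morphisms. *)

Set Implicit Arguments.
Unset Strict Implicit.
Unset Printing Implicit Defensive.

Import GRing.Theory.
Local Open Scope ring_scope.

(** * Global fractions and a criterion for morphisms *)

Section Fractions.
Local Open Scope classical_set_scope.
Variable K : fieldType.
Implicit Types V W : projSpace K.

Lemma multihomogD V d (P Q : hpoly V) :
  multihomog d P -> multihomog d Q -> multihomog d (P + Q).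
Proof.
move=> hP hQ m /msuppD_le; rewrite mem_cat => /orP[/hP|/hQ]; exact.
Qed.

Lemma multihomogM V d e (P Q : hpoly V) :
  multihomog d P -> multihomog e Q ->
  multihomog (fun i => d i + e i)%N (P * Q).
Proof.
move=> hP hQ m /msuppM_le/allpairsP[[m1 m2] /= [/hP h1 /hQ h2 ->]] i.
by rewrite -h1 -h2 -big_split; apply: eq_bigr => j _; rewrite mnmDE.
Qed.

Lemma multihomogC V (c : K) : multihomog (fun=> 0%N) (c%:MP : hpoly V).
Proof.
move=> m; rewrite msuppC; case: eqP => // _; rewrite inE => /eqP-> i.
by rewrite big1 // => j _; rewrite mnm0E.
Qed.

Lemma multihomogX V (j : pcoord V) :
  multihomog (fun i => (pfactor j == i) : nat) ('X_(enum_rank j) : hpoly V).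
Proof.
move=> m; rewrite msuppX inE => /eqP-> i.
rewrite (eq_bigr (fun l => (l == j) : nat)); last first.
  by move=> l _; rewrite mnm1E (inj_eq enum_rank_inj) eq_sym.
have [<-|neq] := eqVneq.
  by rewrite (bigD1 j) //= eqxx big1 // => l /andP[_ /negPf->].
by rewrite big1 // => l /eqP eli; case: eqP => // elj; rewrite -eli elj eqxx in neq.
Qed.

(** Rescaling the homogeneous coordinates of each projective factor multiplies a
    multihomogeneous polynomial by a monomial in the scalars; this makes its
    vanishing, and quotients in equal degrees, independent of representatives. *)
Lemma meval_multihomog V d (P : hpoly V) (c : pindex V -> K)
    (g : pcoord V -> K) :
  multihomog d P ->
  P.@[fun n => c (pfactor (enum_val n)) * g (enum_val n)] =
  (\prod_i c i ^+ d i) * P.@[fun n => g (enum_val n)].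
Proof.
move=> hP; rewrite !mevalE mulr_sumr big_seq [RHS]big_seq.
apply: eq_bigr => m /hP dm; rewrite mulrCA; congr (_ * _).
under eq_bigr do rewrite exprMn; rewrite big_split /=; congr (_ * _).
rewrite (reindex enum_rank) /=; last exact/onW_bij/enum_rank_bij.
rewrite (partition_big (@pfactor K V) xpredT) //=.
apply: eq_bigr => i _; rewrite -dm -prodrXr.
by apply: eq_bigr => j /eqP <-; rewrite enum_rankK.
Qed.

(** Unlike for [regular], a single fraction represents [f] on all of [X].  All the
    functions of this proof are of this kind, and they are much easier to combine:
    no open cover has to be refined. *)
Definition fraction_on V (X : set V) (f : V -> K) : Prop :=
  exists d P Q, [/\ multihomog d P, multihomog d Q &
    forall x, X x -> heval Q x != 0 /\ f x = heval P x / heval Q x].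

Lemma fraction_regular V (X : set V) f : fraction_on X f -> regular X f.
Proof.
move=> [d [P [Q [hP hQ e]]]] x Xx; exists setT; split => //; last first.
  by exists d, P, Q; split => // y Xy _; apply: e.
exists [set 1]; split.
  by move=> _ ->; exists (fun=> 0%N); apply: (multihomogC (V := V)).
apply/seteqP; split=> y //= /(_ 1 erefl); rewrite /heval meval1.
by move/eqP; rewrite oner_eq0.
Qed.

Section Closure.
Variables (V : projSpace K) (X : set V).

Lemma fraction_eq f g :
  (forall x, X x -> f x = g x) -> fraction_on X f -> fraction_on X g.
Proof.
move=> fg [d [P [Q [hP hQ e]]]]; exists d, P, Q; split=> // x Xx.
by rewrite -fg //; apply: e.
Qed.

Lemma fraction_cst c : fraction_on X (fun=> c).
Proof.
exists (fun=> 0%N), c%:MP, 1%:MP; split; try exact: multihomogC.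
by move=> x _; rewrite /heval !mevalC oner_eq0 divr1.
Qed.

Lemma fractionM f g :
  fraction_on X f -> fraction_on X g -> fraction_on X (fun x => f x * g x).
Proof.
move=> [d [P [Q [hP hQ e]]]] [d' [P' [Q' [hP' hQ' e']]]].
exists (fun i => d i + d' i)%N, (P * P'), (Q * Q').
split; try exact: multihomogM.
move=> x Xx; have [q0 ->] := e x Xx; have [q0' ->] := e' x Xx.
by rewrite /heval !mevalM mulf_neq0 // mulf_div.
Qed.

Lemma fractionD f g :
  fraction_on X f -> fraction_on X g -> fraction_on X (fun x => f x + g x).
Proof.
move=> [d [P [Q [hP hQ e]]]] [d' [P' [Q' [hP' hQ' e']]]].
exists (fun i => d i + d' i)%N, (P * Q' + P' * Q), (Q * Q'); split.
- apply: multihomogD; first exact: multihomogM.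
  by rewrite mulrC; apply: multihomogM.
- exact: multihomogM.
- move=> x Xx; have [q0 ->] := e x Xx; have [q0' ->] := e' x Xx.
  by rewrite /heval mevalD !mevalM mulf_neq0 // addf_div.
Qed.

Lemma fractionN f : fraction_on X f -> fraction_on X (fun x => - f x).
Proof.
move=> fX; apply: fraction_eq (fractionM (fraction_cst (-1)) fX) => x _.
by rewrite mulN1r.
Qed.

Lemma fractionV f :
  (forall x, X x -> f x != 0) -> fraction_on X f ->
  fraction_on X (fun x => (f x)^-1).
Proof.
move=> f0 [d [P [Q [hP hQ e]]]]; exists d, Q, P; split=> // x Xx.
have [q0 fE] := e x Xx; rewrite fE invf_div; split=> //.
by apply: contraNneq (f0 x Xx) => p0; rewrite fE p0 mul0r.
Qed.

Lemma fraction_sum (I : Type) (r : seq I) (P : pred I) (f : I -> V -> K) :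
  (forall i, P i -> fraction_on X (f i)) ->
  fraction_on X (fun x => \sum_(i <- r | P i) f i x).
Proof.
move=> hf; elim: r => [|i r IH].
  by apply: fraction_eq (fraction_cst 0) => x _; rewrite big_nil.
case Pi: (P i); last by apply: fraction_eq IH => x _; rewrite big_cons Pi.
by apply: fraction_eq (fractionD (hf i Pi) IH) => x _; rewrite big_cons Pi.
Qed.

Lemma fraction_prod (I : Type) (r : seq I) (P : pred I) (f : I -> V -> K) :
  (forall i, P i -> fraction_on X (f i)) ->
  fraction_on X (fun x => \prod_(i <- r | P i) f i x).
Proof.
move=> hf; elim: r => [|i r IH].
  by apply: fraction_eq (fraction_cst 1) => x _; rewrite big_nil.
case Pi: (P i); last by apply: fraction_eq IH => x _; rewrite big_cons Pi.
by apply: fraction_eq (fractionM (hf i Pi) IH) => x _; rewrite big_cons Pi.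
Qed.

Lemma fractionX f n : fraction_on X f -> fraction_on X (fun x => f x ^+ n).
Proof.
move=> fX; elim: n => [|n IH]; first exact: fraction_cst.
by apply: fraction_eq (fractionM fX IH) => x _; rewrite exprS.
Qed.

Lemma fraction_det n (M : V -> 'M[K]_n) :
  (forall i j, fraction_on X (fun x => M x i j)) ->
  fraction_on X (fun x => \det (M x)).
Proof.
move=> hM; apply: fraction_sum => s _; apply: fractionM.
  exact: fraction_cst.
by apply: fraction_prod.
Qed.

Lemma fraction_mulmx m n p (M : V -> 'M[K]_(m, n)) (N : V -> 'M[K]_(n, p)) :
  (forall i j, fraction_on X (fun x => M x i j)) ->
  (forall i j, fraction_on X (fun x => N x i j)) ->
  forall i j, fraction_on X (fun x => (M x *m N x) i j).
Proof.
move=> hM hN i j.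
apply: (@fraction_eq (fun x => \sum_l M x i l * N x l j)).
  by move=> x _; rewrite mxE.
by apply: fraction_sum => l _; apply: fractionM.
Qed.

Lemma fraction_invmx n (M : V -> 'M[K]_n) :
  (forall x, X x -> M x \in unitmx) ->
  (forall i j, fraction_on X (fun x => M x i j)) ->
  forall i j, fraction_on X (fun x => invmx (M x) i j).
Proof.
move=> uM hM i j.
apply: (@fraction_eq (fun x => (\det (M x))^-1 * \adj (M x) i j)).
  by move=> x Xx; rewrite /invmx uM // [RHS]mxE.
apply: fractionM.
  apply: fractionV (fraction_det hM) => x /uM.
  by rewrite unitmxE unitfE.
apply: (@fraction_eq (fun x => cofactor (M x) j i)).
  by move=> x _; rewrite mxE.
apply: fractionM; first exact: fraction_cst.
apply: fraction_det => a b.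
by apply: fraction_eq (hM (lift j a) (lift i b)) => x _; rewrite !mxE.
Qed.

Lemma fraction_ratio (a b : pcoord V) :
  pfactor a = pfactor b -> (forall x, X x -> hcoord x b != 0) ->
  fraction_on X (fun x => hcoord x a / hcoord x b).
Proof.
move=> eab b0; exists (fun i => (pfactor a == i) : nat).
exists 'X_(enum_rank a), 'X_(enum_rank b); split; first exact: multihomogX.
  by rewrite eab; apply: multihomogX.
by move=> x Xx; rewrite /heval !mevalXU !enum_rankK; split=> //; apply: b0.
Qed.

Lemma fraction_meval n (P : {mpoly K[n]}) (g : 'I_n -> V -> K) :
  (forall i, fraction_on X (g i)) -> fraction_on X (fun x => P.@[g^~ x]).
Proof.
move=> hg; apply: (@fraction_eq (fun x =>
    \sum_(m <- msupp P) P@_m * \prod_i g i x ^+ m i)) => [x _|].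
  by rewrite mevalE.
apply: fraction_sum => m _; apply: fractionM; first exact: fraction_cst.
by apply: fraction_prod => i _; apply: fractionX.
Qed.

End Closure.

Section MorphismCriterion.
Variables (V W : projSpace K) (X : set V) (Y : set W) (phi : V -> W).
Variables (c : V -> pindex W -> K) (f : pcoord W -> V -> K).
Hypothesis c_neq0 : forall x, X x -> forall i, c x i != 0.
Hypothesis phiE : forall x, X x ->
  forall j, hcoord (phi x) j = c x (pfactor j) * f j x.
Hypothesis f_fraction : forall j, fraction_on X (f j).

Let pullback (P : hpoly W) x := P.@[fun n => f (enum_val n) x].

Let pullback_fraction P : fraction_on X (pullback P).
Proof. by apply: fraction_meval => n; apply: f_fraction. Qed.

Let heval_phi d P x : X x -> multihomog d P ->
  heval P (phi x) = (\prod_i c x i ^+ d i) * pullback P x.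
Proof.
move=> Xx hP; rewrite /pullback -(meval_multihomog (c x) (fun j => f j x) hP).
by apply: meval_eq => n; rewrite phiE.
Qed.

Let scale_neq0 x (d : pindex W -> nat) : X x -> \prod_i c x i ^+ d i != 0.
Proof.
by move=> Xx; apply/prodf_neq0 => i _; rewrite expf_neq0 // c_neq0.
Qed.

Let zopen_pullback (U : set W) : zopen U ->
  exists2 U' : set V, zopen U' & X `&` phi @^-1` U = X `&` U'.
Proof.
move=> [S [hS defU]].
(* The numerators of the pullbacks of the equations of the complement of [U]. *)
pose S' : set (hpoly V) := [set P' | exists d P Q', [/\ multihomog d P',
  multihomog d Q', S P &
  forall x, X x -> heval Q' x != 0 /\ pullback P x = heval P' x / heval Q' x]].
exists (~` [set x | forall P, S' P -> heval P x = 0]).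
  rewrite /zopen setCK; exists S'; split=> // P [d [_ [_ [hP _ _ _]]]].
  by exists d.
have UE y : U y <-> ~ forall P, S P -> heval P y = 0.
  have <- : (~` U) y = (forall P, S P -> heval P y = 0) by rewrite defU.
  by rewrite /setC /mkset; split=> [? ?|/contrapT].
apply/seteqP; split=> x [Xx Ux]; split=> //.
  move: Ux => /= /UE Ux S'x; apply: Ux => P SP; have [e hP] := hS P SP.
  have [d [P' [Q' [hP' hQ' PE]]]] := pullback_fraction P.
  rewrite (heval_phi Xx hP); have [_ ->] := PE x Xx.
  by rewrite (S'x P') ?mul0r ?mulr0 //; exists d, P, Q'.
apply/UE => Sx; apply: Ux => P' [d [P [Q' [hP' hQ' SP PE]]]].
have [e hP] := hS P SP; move: (Sx P SP); rewrite (heval_phi Xx hP).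
have [q0 ->] := PE x Xx => /eqP; rewrite !mulf_eq0 invr_eq0 (negPf q0) orbF.
by rewrite (negPf (scale_neq0 _ Xx)) => /eqP.
Qed.

(** A map given in homogeneous coordinates by global fractions [f j], up to a
    non-zero scalar [c x i] on each projective factor, is a morphism: substituting
    the fractions into a multihomogeneous polynomial gives a fraction again, whose
    numerator cuts out the preimage, and the scalars cancel in quotients.  The
    scalars absorb the choice of a basis of each subspace of a flag. *)
Lemma morphism_criterion :
  (forall x, X x -> Y (phi x)) -> morphism_on X Y phi.
Proof.
move=> XY; split=> // U g Uopen greg x [Xx Ux].
have [U1 [U1open U1x [d [P [Q [hP hQ PQ]]]]]] :=
  greg (phi x) (conj (XY x Xx) Ux).
have [U' U'open U'E] := zopen_pullback U1open.
have U'P y : X y -> U' y <-> U1 (phi y).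
  move=> Xy; have := congr1 (fun A : set V => A y) U'E.
  rewrite /setI /preimage /mkset => E.
  split=> [U'y|U1y].
    by have [] : X y /\ U1 (phi y) by rewrite E.
  by have [] : X y /\ U' y by rewrite -E.
exists U'; split=> //; first exact/U'P.
have [dP [P1 [P2 [hP1 hP2 PE]]]] := pullback_fraction P.
have [dQ [Q1 [Q2 [hQ1 hQ2 QE]]]] := pullback_fraction Q.
exists (fun i => dP i + dQ i)%N, (P1 * Q2), (P2 * Q1).
split; [exact: multihomogM | exact: multihomogM |].
move=> y [Xy Uy] /(U'P y Xy) U1y.
have [] := PQ (phi y) (conj (XY y Xy) Uy) U1y.
rewrite (heval_phi Xy hP) (heval_phi Xy hQ) /heval !mevalM /=.
have [p2 ->] := PE y Xy; have [q2 ->] := QE y Xy.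
rewrite /heval in p2 q2 *; rewrite !mulf_eq0 !negb_or => /and3P[s0 q1 _] ->.
split; first by rewrite p2.
by rewrite -mulf_div divff // mul1r invf_div mulf_div.
Qed.

End MorphismCriterion.

End Fractions.

(** * Matrices triangular for an order *)

Section Patterns.
Variables (K : fieldType) (k : nat).
Implicit Types (r s : rel 'I_k) (x y z : 'M[K]_k).

(** A strictly monotone rank makes a relation acyclic, so that matrices supported
    on it are triangular in a suitable numbering. *)
Definition ranked r : Prop :=
  exists h : 'I_k -> nat, forall a b, r a b -> a != b -> (h a < h b)%N.

Definition supported r x : Prop := forall a b, ~~ r a b -> x a b = 0.

(** In the Leibniz formula, a permutation contributing a non-zero term can only
    raise the rank [h]; as it preserves the sum of all ranks, it raises none of
    them and is the identity. *)
Lemma det_ranked r x :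
  ranked r -> supported r x -> \det x = \prod_a x a a.
Proof.
move=> [h hr] sx; rewrite /determinant (bigD1 1%g) //= odd_perm1 expr0 mul1r.
rewrite [X in _ + X]big1 ?addr0; first by apply: eq_bigr => a _; rewrite perm1.
move=> s s1; suff /existsP[a /eqP xa0] : [exists a, x a (s a) == 0].
  by rewrite (bigD1 a) //= xa0 mul0r mulr0.
apply: contraR s1 => /existsPn xn0.
have rs a : r a (s a) by apply: contraR (xn0 a) => /sx ->.
have le_h a : (h a <= h (s a))%N.
  by have [<-//|/hr] := eqVneq a (s a); move/(_ (rs a))/ltnW.
have sum_h : (\sum_a h a = \sum_a h (s a))%N.
  by rewrite (reindex_inj (@perm_inj _ s)).
have /= := leqif_sum (fun a (_ : true) => leqif_eq (le_h a)).
move=> [_]; rewrite sum_h eqxx => /esym/forallP eq_h.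
apply/eqP/permP => a; rewrite perm1; apply/eqP; rewrite eq_sym.
apply: contraT => /(hr _ _ (rs a)).
by have /= /eqP-> := eq_h a; rewrite ltnn.
Qed.

Section Order.
Variable r : rel 'I_k.
Hypotheses (r_refl : reflexive r) (r_trans : transitive r) (r_rank : ranked r).

Lemma ranked_asym a b : r a b -> r b a -> a = b.
Proof.
have [h hr] := r_rank => rab rba; apply/eqP/negPn/negP => ab.
have := ltn_trans (hr _ _ rab ab) (hr _ _ rba (contra_neq esym ab)).
by rewrite ltnn.
Qed.

Lemma supported1 : supported r 1%:M.
Proof. by move=> a b; rewrite mxE; case: eqP => // ->; rewrite r_refl. Qed.

Lemma supportedM x y : supported r x -> supported r y -> supported r (x *m y).
Proof.
move=> sx sy a b rab; rewrite mxE big1 // => c _.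
have [rac|/sx->] := boolP (r a c); last by rewrite mul0r.
by rewrite (sy c b) ?mulr0 //; apply: contra rab; apply: r_trans rac.
Qed.

Lemma supported_unit x :
  supported r x -> (x \in unitmx) = [forall a, x a a != 0].
Proof.
move=> sx; rewrite unitmxE unitfE (det_ranked r_rank sx).
apply/idP/forallP => [/prodf_neq0 x0 a|x0]; first exact: x0.
by apply/prodf_neq0 => a _.
Qed.

(** In [invmx x *m x = 1], the entries of row [a] of the inverse at the [b] with
    [~~ r a b] only involve each other, and vanish by induction on the rank
    of [b]. *)
Lemma supportedV x : supported r x -> supported r (invmx x).
Proof.
move=> sx; have [ux|nux] := boolP (x \in unitmx); last by rewrite invmx_out.
have := ux; rewrite (supported_unit sx) => /forallP x0.
have [h hr] := r_rank => a b.
have [n] := ubnP (h b); elim: n b => // n IH b /ltnSE leb rab.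
have := congr1 (fun z : 'M_k => z a b) (mulVmx ux).
rewrite !mxE (bigD1 b) //= big1 ?addr0; last first.
  move=> c cb; have [rcb|/sx->] := boolP (r c b); last by rewrite mulr0.
  rewrite IH ?mul0r //; first exact: leq_trans (hr _ _ rcb cb) leb.
  by apply: contra rab => rac; apply: r_trans rac rcb.
case: eqP => [ab|_ /eqP]; first by rewrite ab r_refl in rab.
by rewrite mulf_eq0 (negPf (x0 b)) orbF => /eqP.
Qed.

Lemma diag_mulmx x y a :
  supported r x -> supported r y -> (x *m y) a a = x a a * y a a.
Proof.
move=> sx sy; rewrite mxE (bigD1 a) //= big1 ?addr0 // => b ba.
have [rab|/sx->] := boolP (r a b); last by rewrite mul0r.
rewrite (sy b a) ?mulr0 //; apply/negP => rba.
by rewrite (ranked_asym rab rba) eqxx in ba.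
Qed.

Definition triangular x : Prop := supported r x /\ x \in unitmx.

Definition unitriangular x : Prop := supported r x /\ forall a, x a a = 1.

Lemma triangular1 : triangular 1%:M.
Proof. by split; [apply: supported1 | apply: unitmx1]. Qed.

Lemma triangularM x y : triangular x -> triangular y -> triangular (x *m y).
Proof.
by move=> [sx ux] [sy uy]; split; [apply: supportedM | rewrite unitmx_mul ux].
Qed.

Lemma triangularV x : triangular x -> triangular (invmx x).
Proof. by move=> [sx ux]; split; [apply: supportedV | rewrite unitmx_inv]. Qed.

Lemma unitriangular_tri x : unitriangular x -> triangular x.
Proof.
move=> [sx dx]; split=> //; rewrite supported_unit //.
by apply/forallP => a; rewrite dx oner_eq0.
Qed.

Lemma unitriangularM x y :
  unitriangular x -> unitriangular y -> unitriangular (x *m y).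
Proof.
move=> [sx dx] [sy dy]; split; first exact: supportedM.
by move=> a; rewrite diag_mulmx // dx dy mulr1.
Qed.

Lemma unitriangularV x : unitriangular x -> unitriangular (invmx x).
Proof.
move=> ux; have [sx dx] := ux; have [sy uy] := triangularV (unitriangular_tri ux).
split=> // a; have [_ unx] := unitriangular_tri ux.
have := congr1 (fun z : 'M_k => z a a) (mulVmx unx).
by rewrite diag_mulmx // dx mulr1 mxE eqxx.
Qed.

End Order.

Lemma supported_sub r s x : subrel r s -> supported r x -> supported s x.
Proof. by move=> rs sx a b nsab; apply: sx; apply: contra nsab; apply: rs. Qed.

Lemma unitriangular_sub r s x :
  subrel r s -> unitriangular r x -> unitriangular s x.
Proof. by move=> rs [sx dx]; split=> //; apply: supported_sub rs sx. Qed.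

Section Elimination.
Variable S : rel 'I_k.

(** The submatrix of [x] on the successors of [a], padded with an identity so as to
    keep the size [k]. *)
Definition block x (a : 'I_k) : 'M[K]_k :=
  \matrix_(c, b) if S a c && S a b then x c b else (c == b)%:R.

(** Row [a] is the identity row corrected by the solution of the linear system that
    kills the entries of [eliminator x *m x] at the successors of [a].  Solving one
    system for each row shows at once that the entries depend rationally on [x]. *)
Definition eliminator x : 'M[K]_k :=
  \matrix_(a, c) if a == c then 1 else
    if S a c then - \sum_(b | S a b) x a b * invmx (block x a) b c else 0.

Hypothesis S_irr : irreflexive S.

Lemma eliminatorE x a c :
  block x a \in unitmx -> S a c -> (eliminator x *m x) a c = 0.
Proof.
move=> ux Sac; rewrite mxE (bigD1 a) //= mxE eqxx mul1r.
pose g b e := invmx (block x a) b e * block x a e c.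
have -> : \sum_(e | e != a) eliminator x a e * x e c =
          - \sum_(b | S a b) x a b * \sum_e g b e.
  transitivity (\sum_(e | S a e) eliminator x a e * x e c).
    rewrite big_mkcond [RHS]big_mkcond /=; apply: eq_bigr => e _.
    have [->|ea] /= := eqVneq e a; first by rewrite S_irr.
    by rewrite mxE eq_sym (negPf ea); case: (S a e); rewrite ?mul0r.
  under [in RHS]eq_bigr do rewrite mulr_sumr.
  rewrite exchange_big /= -sumrN [RHS](bigID (S a)) /= [X in _ + X]big1 ?addr0.
    apply: eq_bigr => e Sae; rewrite mxE Sae.
    have [ae|_] := eqVneq a e; first by rewrite ae S_irr in Sae.
    rewrite mulNr mulr_suml; congr (- _); apply: eq_bigr => b _.
    by rewrite /g [block x a e c]mxE Sae Sac mulrA.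
  move=> e nSae; rewrite big1 ?oppr0 // => b _.
  rewrite /g [block x a e c]mxE (negPf nSae) /=.
  by case: eqP => [ec|]; [rewrite ec Sac in nSae | rewrite !mulr0].
rewrite -[X in X - _](mulr1) (eq_bigr (fun b => x a b * (b == c)%:R)).
  rewrite (bigD1 c) //= eqxx big1 ?addr0 ?subrr // => b /andP[_ /negPf->].
  by rewrite mulr0.
move=> b _; congr (_ * _); have := mulVmx ux.
by move/(congr1 (fun z : 'M_k => z b c)); rewrite !mxE.
Qed.

Lemma eliminator_uni x : unitriangular (fun a b => (a == b) || S a b) (eliminator x).
Proof.
split=> [a b|a]; last by rewrite mxE eqxx.
by rewrite mxE; case: eqP => //= _; case: (S a b).
Qed.

(** The padded blocks of a triangular matrix are triangular with the same diagonal
    entries or [1]. *)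
Lemma block_unit r x a : reflexive r -> ranked r -> triangular r x ->
  block x a \in unitmx.
Proof.
move=> r_refl rr [sx ux]; have sb : supported r (block x a).
  move=> c b rcb; rewrite mxE; case: ifP => [_|_]; first exact: sx.
  by case: eqP rcb => // ->; rewrite r_refl.
rewrite (supported_unit rr sb); apply/forallP => b; rewrite mxE andbb eqxx.
case: ifP => // _; last exact: oner_neq0.
by move: ux; rewrite (supported_unit rr sx) => /forallP.
Qed.

End Elimination.

End Patterns.

(** * Factoring a unitriangular group along a pair of opposite orders *)

Section Factorization.
Variables (K : fieldType) (k : nat) (p : rel 'I_k).
Hypotheses (p_refl : reflexive p) (p_trans : transitive p) (p_rank : ranked p).
Implicit Types (x y : 'M[K]_k).

Definition strict_part (t : rel 'I_k) : rel 'I_k :=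
  fun a b => [&& p a b, t a b & a != b].

Definition meet_rel (t : rel 'I_k) : rel 'I_k := fun a b => p a b && t a b.

(** The factor of [x] left after clearing its entries along [t]: for [x]
    unitriangular for [p], it is supported on the part of [p] opposite to [t], and
    the inverse of the eliminator is the complementary factor. *)
Definition residue (t : rel 'I_k) x : 'M[K]_k := eliminator (strict_part t) x *m x.

Section OneOrder.
Variable t : rel 'I_k.
Hypotheses (t_refl : reflexive t) (t_trans : transitive t) (t_rank : ranked t).

Lemma meet_refl : reflexive (meet_rel t).
Proof. by move=> a; rewrite /meet_rel p_refl t_refl. Qed.

Lemma meet_trans : transitive (meet_rel t).
Proof.
move=> b a c /andP[pab tab] /andP[pbc tbc].
by rewrite /meet_rel (p_trans pab pbc) (t_trans tab tbc).
Qed.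

Lemma meet_rank : ranked (meet_rel t).
Proof. by have [h hr] := p_rank; exists h => a b /andP[/hr]. Qed.

Lemma meet_subl : subrel (meet_rel t) p.
Proof. by move=> a b /andP[]. Qed.

Lemma meet_subr : subrel (meet_rel t) t.
Proof. by move=> a b /andP[]. Qed.

Lemma strict_irr : irreflexive (strict_part t).
Proof. by move=> a; rewrite /strict_part eqxx !andbF. Qed.

Lemma eliminator_meet x :
  unitriangular (meet_rel t) (eliminator (strict_part t) x).
Proof.
apply: unitriangular_sub (eliminator_uni _ _) => a b /orP[/eqP->|].
  exact: meet_refl.
by case/and3P=> pab tab _; rewrite /meet_rel pab.
Qed.

(** The source of normal forms for the points of a Bruhat cell: [t] is the shape of a
    Borel subgroup and [p] the reverse of the shape of its conjugate by a
    permutation, so that [z] lies in that conjugate and [n] in the unipotent group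
    attached to the cell. *)
Lemma cell_normal_form x : triangular t x ->
  exists2 n, unitriangular (meet_rel t) n &
    exists z, [/\ z \in unitmx, x = n *m z &
      forall a b, p a b -> a != b -> z a b = 0].
Proof.
move=> tx; set y := eliminator (strict_part t) x.
have uy : unitriangular (meet_rel t) y := eliminator_meet x.
have [_ unity] := unitriangular_tri meet_rank uy.
exists (invmx y).
  exact: (unitriangularV meet_refl meet_trans meet_rank).
exists (y *m x); split.
- by rewrite unitmx_mul unity; have [] := tx.
- by rewrite mulKmx.
- move=> a b pab ab; have [tab|ntab] := boolP (t a b).
    apply: eliminatorE => //; first exact: strict_irr.
      exact: block_unit t_refl t_rank tx.
    by rewrite /strict_part pab tab.
  have [sy _] := unitriangular_sub meet_subr uy.
  by have [sx _] := tx; apply: (supportedM t_trans sy sx).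
Qed.

End OneOrder.

Section TwoOrders.
Variables t t' : rel 'I_k.
Hypotheses (t_refl : reflexive t) (t_trans : transitive t).
Hypotheses (t'_refl : reflexive t') (t'_trans : transitive t').
Hypotheses (tt'_total : forall a b, t a b || t' a b).
Hypotheses (tt'_asym : forall a b, t a b -> t' a b -> a = b).

(** Elimination clears the positions of [p] along [t], and multiplying by the
    eliminator does not leave the unitriangular group of [p]. *)
Lemma residue_uni x : unitriangular p x ->
  unitriangular (meet_rel t') (residue t x).
Proof.
move=> ux; have uy := unitriangular_sub (@meet_subl t) (eliminator_meet t_refl x).
have [sz dz] : unitriangular p (residue t x) by apply: unitriangularM.
split=> // a b; rewrite negb_and => /orP[/sz//|nt'ab].
have [pab|/sz//] := boolP (p a b).
apply: eliminatorE; first exact: strict_irr.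
  exact: block_unit p_refl p_rank (unitriangular_tri p_rank ux).
rewrite /strict_part pab; have := tt'_total a b; rewrite (negPf nt'ab) orbF => ->.
by apply: contraNneq nt'ab => ->; rewrite t'_refl.
Qed.

Lemma meet_meet_trivial x :
  unitriangular (meet_rel t) x -> unitriangular (meet_rel t') x -> x = 1%:M.
Proof.
move=> [sx dx] [sx' _]; apply/matrixP => a b; rewrite mxE.
have [->|ab] := eqVneq a b; first by rewrite dx.
have [/andP[pab tab]|/sx//] := boolP (meet_rel t a b).
have [/andP[_ t'ab]|/sx'//] := boolP (meet_rel t' a b).
by rewrite (tt'_asym tab t'ab) eqxx in ab.
Qed.

Lemma residueE x : unitriangular p x ->
  exists2 n, unitriangular (meet_rel t) n & x = n *m residue t x.
Proof.
move=> ux; have uy := eliminator_meet t_refl x.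
exists (invmx (eliminator (strict_part t) x)).
  by apply: unitriangularV => //;
    [apply: meet_refl | apply: meet_trans | apply: meet_rank].
by rewrite mulKmx //; have [] := unitriangular_tri (@meet_rank t) uy.
Qed.

(** Two factorizations differ by a matrix that is unitriangular for [t] and for
    [t'], hence by the identity. *)
Lemma residue_unique n m :
  unitriangular (meet_rel t) n -> unitriangular (meet_rel t') m ->
  residue t (n *m m) = m.
Proof.
move=> un um; have unp := unitriangular_sub (@meet_subl t) un.
have ump := unitriangular_sub (@meet_subl t') um.
have ux : unitriangular p (n *m m) by apply: unitriangularM.
have [n' un' e] := residueE ux; have um' := residue_uni ux.
set m' := residue t _ in e um' *.
have [_ n'U] := unitriangular_tri (@meet_rank t) un'.
have [_ mU] := unitriangular_tri (@meet_rank t') um.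
have e' : invmx n' *m n = m' *m invmx m.
  by apply: (canLR (mulKmx n'U)); rewrite mulmxA -e mulmxK.
suff e1 : m' *m invmx m = 1%:M by rewrite -[m']mulmx1 -(mulVmx mU) mulmxA e1 mul1mx.
apply: meet_meet_trivial; last first.
  apply: unitriangularM => //; first exact: meet_trans.
    exact: meet_rank.
  by apply: unitriangularV => //;
    [apply: meet_refl | apply: meet_trans | apply: meet_rank].
rewrite -e'; apply: unitriangularM => //; first exact: meet_trans.
  exact: meet_rank.
by apply: unitriangularV => //;
    [apply: meet_refl | apply: meet_trans | apply: meet_rank].
Qed.

End TwoOrders.
End Factorization.

(** * Flags of invertible matrices *)

Section NaturalOrders.
Variable k : nat.

Definition leo : rel 'I_k := fun a b => (a <= b)%N.
Definition geo : rel 'I_k := fun a b => (b <= a)%N.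

Lemma leo_refl : reflexive leo. Proof. by move=> a; apply: leqnn. Qed.
Lemma leo_trans : transitive leo. Proof. by move=> b a c; apply: leq_trans. Qed.
Lemma leo_rank : ranked leo.
Proof. by exists val => a b leab ab; rewrite ltn_neqAle ab. Qed.
Lemma geo_refl : reflexive geo. Proof. by move=> a; apply: leqnn. Qed.
Lemma geo_trans : transitive geo.
Proof. by move=> b a c ba cb; apply: leq_trans cb ba. Qed.
Lemma geo_rank : ranked geo.
Proof.
exists (fun a => k - a)%N => a b leba ab; apply: ltn_sub2l; first exact: ltn_ord.
by rewrite ltn_neqAle eq_sym ab.
Qed.

End NaturalOrders.

Local Notation upper := (@triangular _ _ (@leo _)).
Local Notation lower := (@triangular _ _ (@geo _)).

Section FlagsOfMatrices.
Variables (K : fieldType) (k : nat).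
Implicit Types (M N g x : 'M[K]_k) (F : flag K k) (w s : 'S_k) (z : 'cV[K]_k).

Lemma upper1 : upper (1%:M : 'M[K]_k).
Proof. exact: (triangular1 K (@leo_refl k)). Qed.
Lemma upperM x M : upper x -> upper M -> upper (x *m M).
Proof. exact: (triangularM (@leo_trans k)). Qed.
Lemma upperV x : upper x -> upper (invmx x).
Proof. exact: (triangularV (@leo_refl k) (@leo_trans k) (@leo_rank k)). Qed.
Lemma lowerM x M : lower x -> lower M -> lower (x *m M).
Proof. exact: (triangularM (@geo_trans k)). Qed.
Lemma lowerV x : lower x -> lower (invmx x).
Proof. exact: (triangularV (@geo_refl k) (@geo_trans k) (@geo_rank k)). Qed.

(** The inverse makes [pmx w] send the [i]-th basis vector to the [w i]-th. *)
Definition pmx w : 'M[K]_k := perm_mx w^-1.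

Lemma pmxE w a b : pmx w a b = (a == w b)%:R.
Proof. by rewrite !mxE -(inj_eq (@perm_inj _ w)) permKV. Qed.

Lemma pmx_unit w : pmx w \in unitmx. Proof. exact: unitmx_perm. Qed.

Lemma pmx_inv w : invmx (pmx w) = pmx w^-1.
Proof.
by rewrite -[LHS]mulmx1 -[RHS](mulKmx (pmx_unit w)) -perm_mxM mulgV perm_mx1.
Qed.

Lemma pmxM w s : pmx (s * w)%g = pmx w *m pmx s.
Proof. by rewrite /pmx invMg perm_mxM. Qed.

Lemma pmx_mull w m (M : 'M[K]_(k, m)) a b : (pmx w *m M) (w a) b = M a b.
Proof.
rewrite mxE (bigD1 a) //= pmxE eqxx mul1r big1 ?addr0 // => c ca.
by rewrite pmxE (inj_eq perm_inj) eq_sym (negPf ca) mul0r.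
Qed.

Lemma pmx_mulr w M a b : (M *m pmx w) a b = M a (w b).
Proof.
rewrite mxE (bigD1 (w b)) //= pmxE eqxx mulr1 big1 ?addr0 // => c cb.
by rewrite pmxE (negPf cb) mulr0.
Qed.

Lemma mem_coord_flag w (j : 'I_k.+1) z :
  (z \in coord_flag K w j) = [forall i : 'I_k, (j <= i)%N ==> (z (w i) 0 == 0)].
Proof.
rewrite /= ffunE; apply/idP/forallP => [zj i|z0].
  apply/implyP => ji; have := coord_span (X := in_tuple (coord_seq K w j)) zj.
  move=> ->; rewrite summxE big1 // => l _; rewrite mxE.
  have : (coord_seq K w j)`_l \in coord_seq K w j by apply: mem_nth.
  move=> /mapP[a]; rewrite mem_filter => /andP[aj _] ->.
  rewrite mxE (inj_eq perm_inj); case: eqP => [ia|]; last by rewrite mulr0.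
  by move: ji; rewrite ia leqNgt aj.
have -> : z = \sum_i z (w i) 0 *: delta_mx (w i) 0.
  rewrite {1}(matrix_sum_delta z) (reindex_inj (@perm_inj _ w)) /=.
  by apply: eq_bigr => i _; rewrite big_ord1.
apply: memv_suml => i _; have [ij|ji] := ltnP i j; last first.
  by move: (z0 i); rewrite ji => /eqP->; rewrite scale0r mem0v.
apply/memvZ/memv_span/mapP; exists i => //.
by rewrite mem_filter ij mem_enum.
Qed.

Lemma mem_std_flag (j : 'I_k.+1) z :
  (z \in std_flag K k j) = [forall i : 'I_k, (j <= i)%N ==> (z i 0 == 0)].
Proof. by rewrite mem_coord_flag; apply: eq_forallb => i; rewrite perm1. Qed.

Lemma flag_eq F F' : (forall j, F j = F' j) -> F = F'.
Proof. by move=> e; apply/val_inj/ffunP. Qed.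

Definition flag_fun M : {ffun 'I_k.+1 -> {vspace 'cV[K]_k}} :=
  [ffun j => (linfun (mulmx M) @: std_flag K k j)%VS].

Lemma flag_fun_is_flag M : M \in unitmx -> is_flag (flag_fun M).
Proof.
move=> uM; have /andP[/forallP d /forallP m] := valP (std_flag K k).
apply/andP; split; apply/forallP => i; last first.
  apply/forallP => j; apply/implyP => ij; rewrite [X in (X <= _)%VS]ffunE.
  rewrite [X in (_ <= X)%VS]ffunE limgS //.
  by have /forallP/(_ j)/implyP/(_ ij) := m i.
rewrite ffunE limg_dim_eq ?(eqP (d i)) //; apply/eqP; rewrite -subv0.
apply/subvP => z; rewrite memv_cap memv_ker lfunE /= => /andP[_ /eqP Mz0].
by rewrite memv0 -[z](mulKmx uM) Mz0 mulmx0.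
Qed.

(** The image of the standard flag under [M]; the default value of [insubd] only
    occurs for singular [M]. *)
Definition flag_of M : flag K k := insubd (std_flag K k) (flag_fun M).

Lemma flag_ofE M j : M \in unitmx ->
  flag_of M j = (linfun (mulmx M) @: std_flag K k j)%VS.
Proof.
by move=> uM; rewrite /= insubdK ?ffunE //; apply: flag_fun_is_flag.
Qed.

Lemma mem_flag_of M j z : M \in unitmx ->
  (z \in flag_of M j) = (invmx M *m z \in std_flag K k j).
Proof.
move=> uM; rewrite flag_ofE //; apply/memv_imgP/idP => [[y yj ->]|zj].
  by rewrite lfunE /= mulKmx.
by exists (invmx M *m z); rewrite // lfunE /= mulKVmx.
Qed.

Lemma upper_std x j z : supported (@leo k) x -> z \in std_flag K k j ->
  x *m z \in std_flag K k j.
Proof.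
rewrite !mem_std_flag => sx /forallP z0; apply/forallP => i; apply/implyP => ji.
rewrite mxE big1 // => a _; have [ia|ai] := leqP i a.
  by have /implyP/(_ (leq_trans ji ia))/eqP-> := z0 a; rewrite mulr0.
by rewrite sx ?mul0r // /leo -ltnNge.
Qed.

(** The stabilizer of the standard flag is the group of upper triangular matrices:
    the [b]-th column of [N] lies in the subspace of dimension [b.+1] of both flags,
    which bounds the support of the [b]-th column of [invmx M *m N]. *)
Lemma flag_of_inj M N : M \in unitmx -> N \in unitmx ->
  flag_of M = flag_of N <-> upper (invmx M *m N).
Proof.
move=> uM uN; split=> [e|uMN].
  split; last by rewrite unitmx_mul unitmx_inv uM.
  move=> a b; rewrite /leo -ltnNge => ba.
  have : N *m delta_mx b (0 : 'I_1) \in flag_of M (inord b.+1).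
    rewrite e mem_flag_of // mulKmx // mem_std_flag; apply/forallP => i.
    rewrite inordK ?ltnS ?ltn_ord //; apply/implyP => bi; rewrite mxE.
    by have [ib|] := eqVneq i b; [rewrite ib ltnn in bi | rewrite eqxx].
  rewrite mem_flag_of // mem_std_flag => /forallP/(_ a).
  rewrite inordK ?ltnS ?ltn_ord // ba mulmxA -colE.
  by rewrite [X in X == _]mxE => /eqP.
apply: flag_eq => j; apply/vspaceP => z; rewrite !mem_flag_of //.
have [sT uT] := uMN; apply/idP/idP => zj.
  have -> : invmx N *m z = (invmx N *m M) *m (invmx M *m z).
    by rewrite -mulmxA mulKVmx.
  have [sT' _] := upperV uMN.
  suff -> : invmx N *m M = invmx (invmx M *m N) by apply: upper_std sT' zj.
  apply: (can_inj (mulKmx uT)); rewrite mulmxV // -mulmxA mulKVmx //.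
  by rewrite mulVmx.
have -> : invmx M *m z = (invmx M *m N) *m (invmx N *m z).
  by rewrite -mulmxA mulKVmx.
exact: upper_std sT zj.
Qed.

Lemma flag_of_upper M x : M \in unitmx -> upper x -> flag_of (M *m x) = flag_of M.
Proof.
move=> uM ux; apply/esym/flag_of_inj => //; last by rewrite mulKmx.
by rewrite unitmx_mul uM; have [] := ux.
Qed.

Lemma flag_of_pmx w : flag_of (pmx w) = coord_flag K w.
Proof.
apply: flag_eq => j; apply/vspaceP => z.
rewrite mem_flag_of ?pmx_unit // mem_std_flag mem_coord_flag.
apply: eq_forallb => i; congr (_ ==> (_ == _)); rewrite pmx_inv.
rewrite mxE (bigD1 (w i)) //= pmxE permK eqxx mul1r big1 ?addr0 // => a ai.
rewrite pmxE; case: eqP => [e|]; last by rewrite mul0r.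
by rewrite e permKV eqxx in ai.
Qed.

Lemma flag_of1 : flag_of 1%:M = std_flag K k.
Proof. by rewrite /std_flag -flag_of_pmx /pmx invg1 perm_mx1. Qed.

Lemma maps_flag_of g M F : g \in unitmx -> M \in unitmx ->
  maps_flag g (flag_of M) F <-> F = flag_of (g *m M).
Proof.
move=> ug uM; have ugM : g *m M \in unitmx by rewrite unitmx_mul ug.
have e j : (linfun (mulmx g) @: flag_of M j)%VS = flag_of (g *m M) j.
  rewrite !flag_ofE // -limg_comp; congr (_ @: _)%VS; apply/lfunP => z.
  by rewrite comp_lfunE !lfunE /= mulmxA.
split=> [h|-> j]; last exact: e.
by apply: flag_eq => j; rewrite -h e.
Qed.

Lemma maps_to_std g F : g \in unitmx -> maps_flag g F (std_flag K k) ->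
  F = flag_of (invmx g).
Proof.
move=> ug h; have ug' : invmx g \in unitmx by rewrite unitmx_inv.
apply: flag_eq => j; apply/vspaceP => z; rewrite mem_flag_of // invmxK -h.
apply/idP/memv_imgP => [zj|[y yj]]; first by exists z; rewrite ?lfunE.
by rewrite lfunE /= => /(can_inj (mulKmx ug)) ->.
Qed.

Lemma rel_pos_flag_of s F F' : rel_pos s F F' ->
  exists2 M, M \in unitmx & F = flag_of M.
Proof.
move=> [g ug [/(maps_to_std ug) -> _]]; exists (invmx g) => //.
by rewrite unitmx_inv.
Qed.

(** The relative position is the double coset of [invmx M *m N] modulo upper
    triangular matrices. *)
Lemma rel_posP s M N : M \in unitmx -> N \in unitmx ->
  rel_pos s (flag_of M) (flag_of N) <->
  exists b b', [/\ upper b, upper b' & N = M *m b *m pmx s *m b'].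
Proof.
move=> uM uN; split=> [[g ug []]|[b [b' [ub ub' e]]]].
  move=> /(maps_flag_of _ ug uM); rewrite -flag_of1 => /flag_of_inj.
  rewrite unitmx1 unitmx_mul ug uM invmx1 mul1mx => /(_ isT isT) gM.
  move=> /(maps_flag_of _ ug uN); rewrite -flag_of_pmx => /flag_of_inj.
  rewrite pmx_unit unitmx_mul ug uN => /(_ isT isT) gN.
  exists (invmx (g *m M)), (invmx (pmx s) *m (g *m N)); split=> //.
    exact: upperV.
  rewrite !mulmxA mulmxK ?pmx_unit // -[RHS]mulmxA -[RHS]mulmxA.
  apply: (canRL (mulKVmx uM)).
  apply: (canRL (mulKmx (proj2 gM))).
  by rewrite !mulmxA mulmxK.
have [[_ Ub] [_ Ub']] := (ub, ub').
exists (invmx b *m invmx M); first by rewrite unitmx_mul !unitmx_inv Ub.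
have u' : invmx b *m invmx M \in unitmx by rewrite unitmx_mul !unitmx_inv Ub.
split.
  apply/(maps_flag_of _ u' uM); rewrite mulmxKV // -flag_of1.
  by rewrite -[invmx b]mul1mx flag_of_upper ?unitmx1 //; apply: upperV.
apply/(maps_flag_of _ u' uN); rewrite e -!mulmxA mulKmx // mulKmx //.
by rewrite flag_of_upper ?pmx_unit // flag_of_pmx.
Qed.

End FlagsOfMatrices.

(** * Bruhat cells and translated big cells *)

Section Cells.
Variables (K : fieldType) (k : nat).
Implicit Types (M N x b c : 'M[K]_k) (F : flag K k) (u v w : 'S_k).

Definition in_cell w M :=
  exists b b', [/\ upper b, upper b' & M = b *m pmx K w *m b'].
Definition in_opposite_cell u M :=
  exists c b, [/\ lower c, upper b & M = c *m pmx K u *m b].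
Definition in_chart v M :=
  exists c b, [/\ lower c, upper b & M = pmx K v *m c *m b].

Lemma in_cell_mull w b M : upper b -> in_cell w (b *m M) <-> in_cell w M.
Proof.
move=> ub; have [_ Ub] := ub.
split=> -[a [b' [ua ub' e]]]; [exists (invmx b *m a)|exists (b *m a)]; exists b'.
  split=> //; first exact: upperM (upperV ub) ua.
  by rewrite -!mulmxA -[M](mulKmx Ub) e !mulmxA.
by split=> //; [apply: upperM | rewrite e !mulmxA].
Qed.

Lemma in_opposite_cell_mull u c M :
  lower c -> in_opposite_cell u (c *m M) <-> in_opposite_cell u M.
Proof.
move=> lc; have [_ Uc] := lc.
split=> -[a [b' [ua ub' e]]]; [exists (invmx c *m a)|exists (c *m a)]; exists b'.
  split=> //; first exact: lowerM (lowerV lc) ua.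
  by rewrite -!mulmxA -[M](mulKmx Uc) e !mulmxA.
by split=> //; [apply: lowerM | rewrite e !mulmxA].
Qed.

Lemma longestK : ((longest k)^-1 = longest k)%g.
Proof.
apply/permP => i; apply: (@perm_inj _ (longest k)); rewrite permKV !permE.
by rewrite rev_ordK.
Qed.

Lemma pmx_longestV : invmx (pmx K (longest k)) = pmx K (longest k).
Proof. by rewrite pmx_inv longestK. Qed.

Lemma longest_conjE (x : 'M[K]_k) (a b : 'I_k) :
  (pmx K (longest k) *m x *m pmx K (longest k)) a b =
  x (longest k a) (longest k b).
Proof.
by rewrite pmx_mulr -[a in LHS](permKV (longest k)) pmx_mull longestK.
Qed.

Lemma lower_longest b : upper b ->
  lower (pmx K (longest k) *m b *m pmx K (longest k)).
Proof.
move=> [sb ub]; split; last by rewrite !unitmx_mul !pmx_unit ub.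
move=> i j nij; rewrite longest_conjE; apply: sb; apply: contra nij.
by rewrite /leo /geo !permE /=; have := ltn_ord i; have := ltn_ord j; lia.
Qed.

Lemma upper_longest c : lower c ->
  upper (pmx K (longest k) *m c *m pmx K (longest k)).
Proof.
move=> [sc uc]; split; last by rewrite !unitmx_mul !pmx_unit uc.
move=> i j nij; rewrite longest_conjE; apply: sc; apply: contra nij.
by rewrite /leo /geo !permE /=; have := ltn_ord i; have := ltn_ord j; lia.
Qed.

(** Relative positions to flags opposite to [w0] are tested by lower triangular
    matrices, because the conjugate of an upper triangular matrix by [w0] is lower
    triangular. *)
Lemma rel_pos_longestP M u s : M \in unitmx ->
  rel_pos (longest k * s)%g (flag_of M) (coord_flag K (longest k * u)%g) <->
  exists c b, [/\ lower c, upper b & M = pmx K u *m c *m invmx (pmx K s) *m b].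
Proof.
move=> uM; rewrite -flag_of_pmx (rel_posP _ uM (pmx_unit _ _)) !pmxM.
set W := pmx K (longest k); have uW : W \in unitmx by apply: pmx_unit.
have WV : invmx W = W := pmx_longestV; have uS := pmx_unit K s.
have uU := pmx_unit K u.
split=> [[b [b' [ub ub' e]]]|[c [b [uc ub e]]]].
  have [[_ Ub] [_ Ub']] := (ub, ub').
  exists (W *m invmx b' *m invmx W), (invmx b); split; try exact: upperV.
    by rewrite WV; apply/lower_longest/upperV.
  by rewrite !mulmxA e !mulmxA !mulmxK.
have [[_ Ub] [_ Uc]] := (ub, uc).
exists (invmx b), (invmx W *m invmx c *m W); split; first exact: upperV.
  by rewrite WV; apply/upper_longest/lowerV.
by rewrite !mulmxA e !(mulmxK, mulmxKV).
Qed.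

Lemma richardson_flag_of u w M : M \in unitmx ->
  richardson K u w (flag_of M) <-> in_cell w M /\ in_opposite_cell u M.
Proof.
move=> uM; rewrite /richardson /mkset -flag_of1.
have -> : ant_flag K k = coord_flag K (longest k * 1)%g by rewrite mulg1.
rewrite (rel_posP _ (unitmx1 _ _) uM) (rel_pos_longestP _ _ uM).
by rewrite -pmx_inv invmxK /in_cell /in_opposite_cell /pmx invg1 perm_mx1;
  split=> -[[b [b' [ub ub' eb]]] [c [b2 [uc ub2 ec]]]]; split;
  [exists b, b' | exists c, b2 | exists b, b' | exists c, b2]; split=> //;
  rewrite ?mul1mx // in eb ec *.
Qed.

Lemma in_chart_rel v M : M \in unitmx ->
  rel_pos (longest k) (flag_of M) (coord_flag K (longest k * v)%g) <->
  in_chart v M.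
Proof.
move=> uM; rewrite -{1}[longest k]mulg1 (rel_pos_longestP _ _ uM).
by rewrite {2}/pmx invg1 perm_mx1 invmx1; split=> -[c [b [uc ub e]]];
  exists c, b; rewrite mulmx1 in e *.
Qed.

Lemma richardson_flagP u w F : richardson K u w F ->
  exists2 M, M \in unitmx & F = flag_of M.
Proof. by case=> _; apply: rel_pos_flag_of. Qed.

End Cells.

Section NormalForms.
Variables (K : fieldType) (k : nat) (v : 'S_k).
Implicit Types (M x : 'M[K]_k).
Notation V := (pmx K v).

(** Conjugation by [pmx v] turns the lower triangular matrices into the matrices
    supported on this order. *)
Definition chart_order : rel 'I_k := fun a b => ((v^-1)%g b <= (v^-1)%g a)%N.
Notation p := chart_order.

Lemma chart_order_refl : reflexive p. Proof. by move=> a; apply: leqnn. Qed.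
Lemma chart_order_trans : transitive p.
Proof. by move=> b a c ba cb; apply: leq_trans cb ba. Qed.
Lemma chart_order_rank : ranked p.
Proof.
exists (fun a => k - (v^-1)%g a)%N => a b leba ab.
apply: ltn_sub2l; first exact: ltn_ord.
by rewrite ltn_neqAle (inj_eq val_inj) (inj_eq perm_inj) eq_sym ab.
Qed.

Let conjE x a b : (invmx V *m x *m V) a b = x (v a) (v b).
Proof.
by rewrite pmx_mulr pmx_inv -[a in LHS](permK v) pmx_mull.
Qed.

Lemma in_chart_unitriangular x : unitriangular p x -> in_chart v (x *m V).
Proof.
move=> ux; have [_ Ux] := unitriangular_tri chart_order_rank ux.
exists (invmx V *m x *m V), 1%:M; split; last 1 first.
- by rewrite mulmx1 !mulmxA mulmxV ?pmx_unit // mul1mx.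
- split; last by rewrite !unitmx_mul unitmx_inv !pmx_unit Ux.
  move=> a b nab; rewrite conjE; have [sx _] := ux; apply: sx.
  by rewrite /p !permK.
- exact: upper1.
Qed.

(** The condition on [z] says that its conjugate by [pmx v] is upper triangular. *)
Lemma flag_of_absorb x z : unitriangular p x -> z \in unitmx ->
  (forall a b, p a b -> a != b -> z a b = 0) ->
  flag_of (x *m z *m V) = flag_of (x *m V).
Proof.
move=> ux uz z0; have [_ Ux] := unitriangular_tri chart_order_rank ux.
have -> : x *m z *m V = x *m V *m (invmx V *m z *m V).
  by rewrite !mulmxA mulmxK // pmx_unit.
apply: flag_of_upper; first by rewrite unitmx_mul Ux pmx_unit.
split; last by rewrite !unitmx_mul unitmx_inv !pmx_unit uz.
move=> a b; rewrite /leo -ltnNge conjE => ba; apply: z0.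
  by rewrite /p !permK ltnW.
by rewrite (inj_eq perm_inj) -val_eqE /= neq_ltn ba orbT.
Qed.

Section CellNormalForm.
Variable t : rel 'I_k.
Hypotheses (t_refl : reflexive t) (t_trans : transitive t) (t_rank : ranked t).

(** Used with [t] the natural order for the Schubert cell of [v], and with its
    reverse for the opposite cell. *)
Lemma cell_flag_of b b' : triangular t b -> upper b' ->
  exists2 n : 'M[K]_k, unitriangular (meet_rel p t) n &
    flag_of (b *m V *m b') = flag_of (n *m V).
Proof.
move=> tb ub'; have [_ Ub] := tb.
rewrite flag_of_upper ?unitmx_mul ?pmx_unit ?Ub //.
have [n un [z [uz -> z0]]] := cell_normal_form chart_order_refl
  chart_order_trans chart_order_rank t_refl t_trans t_rank tb.
exists n => //; apply: flag_of_absorb => //.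
exact: unitriangular_sub (@meet_subl _ _ t) un.
Qed.

End CellNormalForm.

Definition leading_order : rel 'I_k := fun a b => (b < a)%N.

(** LU factorization: the padded blocks are the leading principal submatrices of
    [invmx V *m M], so eliminating below the diagonal is possible and leaves an upper
    triangular matrix. *)
Lemma lu_flag_of M : M \in unitmx ->
  (forall a, block leading_order (invmx V *m M) a \in unitmx) ->
  exists2 x : 'M[K]_k, unitriangular p x & flag_of M = flag_of (x *m V).
Proof.
move=> uM blocks; set L := invmx V *m M.
set y := eliminator leading_order L.
have lirr : irreflexive leading_order by move=> a; apply: ltnn.
have uy : unitriangular (@geo k) y.
  apply: unitriangular_sub (eliminator_uni _ _) => a b /orP[/eqP->|/ltnW//].
  exact: leqnn.
have [_ Uy] := unitriangular_tri (@geo_rank k) uy.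
have upyL : upper (y *m L).
  split; last by rewrite !unitmx_mul Uy unitmx_inv pmx_unit.
  move=> a b; rewrite /leo -ltnNge => ba.
  exact: eliminatorE.
have [sy' dy'] := unitriangularV (@geo_refl k) (@geo_trans k) (@geo_rank k) uy.
exists (V *m invmx y *m invmx V).
  split=> [a b nab|a].
    by rewrite pmx_inv pmx_mulr -[a](permKV v) pmx_mull sy'.
  by rewrite pmx_inv pmx_mulr -[a](permKV v) pmx_mull permK dy'.
rewrite -[LHS](flag_of_upper _ (upperV upyL)) //.
rewrite mulmxKV; last exact: pmx_unit.
congr flag_of.
have [_ UyL] := upyL; apply: (canLR (mulmxK UyL)).
by rewrite /L !mulmxA mulmxKV // mulmxV ?pmx_unit // mul1mx.
Qed.

Lemma in_chart_flag_of M : M \in unitmx -> in_chart v M ->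
  exists2 x : 'M[K]_k, unitriangular p x & flag_of M = flag_of (x *m V).
Proof.
move=> uM [c [b [lc ub e]]]; have [_ Uc] := lc.
rewrite e flag_of_upper ?unitmx_mul ?pmx_unit ?Uc //.
apply: lu_flag_of; first by rewrite unitmx_mul pmx_unit.
move=> a; rewrite mulKmx ?pmx_unit //.
exact: block_unit (@geo_refl k) (@geo_rank k) lc.
Qed.

End NormalForms.

(** * Plücker coordinates and normal forms *)

Section Minors.
Variables (K : fieldType) (k : nat).
Implicit Types (M N x : 'M[K]_k) (F : flag K k) (v : 'S_k) (A : {set 'I_k}).

Lemma card_le A : (#|A| <= k)%N.
Proof. by rewrite -[X in (_ <= X)%N]card_ord max_card. Qed.

Definition minor M A : K :=
  \det (\matrix_(a < #|A|, b < #|A|) M (enum_val a) (widen_ord (card_le A) b)).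

(** The chosen basis of the [n]-th subspace, in coordinates with respect to the first
    [n] columns of [M]. *)
Definition basis_mx M n (nk : (n <= k)%N) : 'M[K]_n :=
  \matrix_(a < n, b < n)
    (invmx M *m (vbasis (flag_of M (inord n)))`_b) (widen_ord nk a) 0.

Lemma dim_flag F n : (n <= k)%N -> \dim (F (inord n)) = n.
Proof.
move=> nk; have /andP[/forallP/(_ (inord n))/eqP-> _] := valP F.
by rewrite inordK.
Qed.

Lemma vbasis_nth_std M n (b : 'I_n) (i : 'I_k) : M \in unitmx -> (n <= k)%N ->
  (n <= i)%N -> (invmx M *m (vbasis (flag_of M (inord n)))`_b) i 0 = 0.
Proof.
move=> uM nk ni; set z := nth _ _ _.
have : z \in flag_of M (inord n).
  apply: vbasis_mem; apply: mem_nth.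
  by rewrite size_tuple dim_flag.
rewrite mem_flag_of // mem_std_flag => /forallP/(_ i).
by rewrite inordK ?ltnS // ni => /eqP.
Qed.

Lemma basis_mx_unit M n (nk : (n <= k)%N) : M \in unitmx ->
  \det (basis_mx M nk) != 0.
Proof.
move=> uM; rewrite -det_tr; apply/det0P => -[c c0 cB].
set U := flag_of M (inord n); have dU : \dim U = n := dim_flag _ nk.
have fr : free (vbasis U) := basis_free (vbasisP U).
move/freeP: fr => /(_ (fun b => c 0 (cast_ord dU b))) fr.
suff : \sum_(b < \dim U) c 0 (cast_ord dU b) *: (vbasis U)`_b = 0.
  move=> /fr c0'; case/eqP: c0; apply/rowP => b; rewrite mxE.
  by rewrite -[b](cast_ordKV dU) c0'.
have -> : \sum_(b < \dim U) c 0 (cast_ord dU b) *: (vbasis U)`_b =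
    \sum_(b < n) c 0 b *: (vbasis U)`_b.
  rewrite [RHS](reindex (cast_ord dU)) //=; apply: onW_bij.
  by exists (cast_ord (esym dU)); [apply: cast_ordK | apply: cast_ordKV].
have uM' : invmx M \in unitmx by rewrite unitmx_inv.
apply: (can_inj (mulKmx uM')).
rewrite mulmx0 mulmx_sumr; apply/colP => i; rewrite summxE mxE.
have [ni|ni] := leqP n i.
  by rewrite big1 // => b _; rewrite -scalemxAr mxE vbasis_nth_std ?mulr0.
have /rowP/(_ (Ordinal ni)) := cB; rewrite [LHS]mxE [RHS]mxE => e.
rewrite -[RHS]e; apply: eq_bigr => b _.
rewrite -scalemxAr mxE [_^T _ _]mxE [basis_mx _ _ _ _]mxE.
by congr (_ * (_ *m _) _ _); apply: val_inj.
Qed.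

Definition basis_det M (j : 'I_k.+1) : K := \det (basis_mx M (leq_ord j)).

Lemma basis_det_neq0 M j : M \in unitmx -> basis_det M j != 0.
Proof. exact: basis_mx_unit. Qed.

(** Changing the basis of a subspace multiplies all its maximal minors by one
    determinant. *)
Lemma plucker_flag_of M A : M \in unitmx ->
  plucker (flag_of M) A = basis_det M (inord #|A|) * minor M A.
Proof.
move=> uM; have -> : basis_det M (inord #|A|) = \det (basis_mx M (card_le A)).
  rewrite /basis_det; move: (leq_ord _); rewrite inordK ?ltnS ?card_le // => h.
  by rewrite (bool_irrelevance h (card_le A)).
rewrite mulrC -det_mulmx; congr (\det _); apply/matrixP => a b; rewrite !mxE.
set z := nth _ _ _; rewrite -[z](mulKVmx uM) mxE.
rewrite (bigID (fun l : 'I_k => (l < #|A|)%N)) /= [X in _ + X]big1 ?addr0.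
  rewrite (big_ord_narrow (card_le A)) /=; apply: eq_bigr => l _.
  by rewrite mxE [basis_mx _ _ _ _]mxE.
move=> l; rewrite -leqNgt => Al.
by rewrite vbasis_nth_std ?card_le // mulr0.
Qed.

(** The rows of the minor that isolates the entry [(v i, v j)] of a normal form [x]:
    the columns before [j] of [x *m pmx K v] have an echelon shape with pivots [1]
    at the rows [v c], [c < j]. *)
Definition step_set v (i j : 'I_k) : {set 'I_k} :=
  v i |: v @: [set c : 'I_k | (c < j)%N].

(** The increasing enumeration of [step_set v i j] does not display the echelon
    shape; this one does, at the cost of a sign that depends on [v], [i] and [j]
    only. *)
Definition step_seq n (nk : (n <= k)%N) v (i j : 'I_k) (c : 'I_n) : 'I_k :=
  if (c < j)%N then v (widen_ord nk c) else v i.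

Section Step.
Variables (v : 'S_k) (i j : 'I_k).
Hypothesis ji : (j <= i)%N.
Notation A := (step_set v i j).

Lemma card_step : #|A| = j.+1.
Proof.
rewrite cardsU1 card_imset; last exact: perm_inj.
have -> : #|[set c : 'I_k | (c < j)%N]| = j.
  rewrite -sum1_card (eq_bigl (fun c : 'I_k => (c < j)%N)); last first.
    by move=> c; rewrite inE.
  rewrite (big_ord_narrow (ltnW (ltn_ord j))) /=.
  by rewrite sum1_card card_ord.
suff -> : v i \notin v @: [set c : 'I_k | (c < j)%N] by [].
by apply/imsetP => -[c cj /perm_inj ic]; move: cj; rewrite inE -ic ltnNge ji.
Qed.

Lemma minor_step : exists2 e : K, e != 0 & forall M,
  minor M A = e * \det (\matrix_(a < #|A|, b < #|A|)
    M (step_seq (card_le A) v i j a) (widen_ord (card_le A) b)).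
Proof.
have fA c : step_seq (card_le A) v i j c \in A.
  rewrite /step_seq; case: ifP => [cj|_]; last by rewrite !inE eqxx.
  by rewrite !inE imset_f ?orbT // inE.
have f_inj : injective (step_seq (card_le A) v i j).
  have bd (c : 'I_#|A|) : (c < j.+1)%N by rewrite -card_step.
  move=> c d; rewrite /step_seq; have := bd c; have := bd d; rewrite !ltnS.
  case: ltnP => [cj|jc]; case: ltnP => [dj|jd] ledj lecj /perm_inj.
  - by move/(congr1 val) => /= ?; apply: val_inj.
  - by move/(congr1 val) => /= ci; move: cj; rewrite ci ltnNge ji.
  - by move/(congr1 val) => /= ci; move: dj; rewrite -ci ltnNge ji.
  - by move=> _; apply: val_inj; apply/eqP; rewrite /= eqn_leq
      (leq_trans lecj jd) (leq_trans ledj jc).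
have vA : v i \in A by rewrite !inE eqxx.
pose r c := enum_rank_in vA (step_seq (card_le A) v i j c).
have rK c : enum_val (r c) = step_seq (card_le A) v i j c.
  by rewrite enum_rankK_in.
have r_inj : injective r.
  by move=> c d /(congr1 enum_val); rewrite !rK; apply: f_inj.
exists ((-1) ^+ (perm r_inj)) => [|M]; first by rewrite signr_eq0.
rewrite /minor; set m := \matrix_(_, _) _; set m' := \matrix_(_, _) _.
have -> : m' = row_perm (perm r_inj) m.
  by apply/matrixP => a b; rewrite !mxE permE rK.
by rewrite row_permE det_mulmx det_perm mulrA -expr2 sqrr_sign mul1r.
Qed.

(** In the order of [step_seq] the minor is lower triangular; its diagonal entries
    are equal to [1], except the last one. *)
Lemma det_step n (nk : (n <= k)%N) x : n = j.+1 ->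
  unitriangular (chart_order v) x ->
  \det (\matrix_(a < n, b < n)
    (x *m pmx K v) (step_seq nk v i j a) (widen_ord nk b)) = x (v i) (v j).
Proof.
move=> nj [sx dx]; subst n; rewrite det_trig; last first.
  apply/is_trig_mxP => a b ab; rewrite mxE pmx_mulr sx //.
  rewrite /chart_order permK -ltnNge /step_seq; have := ltn_ord b.
  case: ifP => [_ _|/negbT]; first by rewrite permK.
  by rewrite -leqNgt ltnS => ja bj; move: (leq_ltn_trans ja ab); rewrite ltnNge bj.
rewrite big_ord_recr big1 /= ?mul1r.
  rewrite mxE pmx_mulr /step_seq /= ltnn.
  by congr (x _ (v _)); apply: val_inj.
move=> a _; rewrite mxE pmx_mulr /step_seq /= ltn_ord.
by rewrite -[RHS](dx (v (widen_ord nk (widen_ord (leqnSn j) a))));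
   congr (x (v _) (v _)); apply: val_inj.
Qed.

End Step.

(** All the entries that may be non-zero in a normal form are [1], so that the minor
    on [step_set v i j] is the sign of the corresponding reordering of the rows. *)
Definition full_chart_mx v : 'M[K]_k := \matrix_(a, b) (chart_order v a b)%:R.

Definition step_sign v (i j : 'I_k) : K :=
  minor (full_chart_mx v *m pmx K v) (step_set v i j).

Lemma full_chart_uni v : unitriangular (chart_order v) (full_chart_mx v).
Proof.
split=> [a b /negPf nab|a]; first by rewrite mxE nab.
by rewrite mxE chart_order_refl.
Qed.

Lemma step_sign_neq0 v (i j : 'I_k) : (j <= i)%N -> step_sign v i j != 0.
Proof.
move=> ji; have [e e0 eE] := minor_step v ji; rewrite /step_sign eE.
rewrite (det_step _ _ (card_step v ji) (full_chart_uni v)) mxE.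
by rewrite /chart_order !permK ji mulr1.
Qed.

Lemma minor_unitriangular v (i j : 'I_k) x : (j <= i)%N ->
  unitriangular (chart_order v) x ->
  minor (x *m pmx K v) (step_set v i j) = step_sign v i j * x (v i) (v j).
Proof.
move=> ji ux; have [e e0 eE] := minor_step v ji; rewrite /step_sign !eE.
rewrite !(det_step _ _ (card_step v ji)) //; last exact: full_chart_uni.
by rewrite [full_chart_mx _ _ _]mxE /chart_order !permK ji mulr1.
Qed.

(** If [F] comes from [x *m pmx K v], the minor of this matrix on
    [step_set v i j] is [x (v i) (v j)], up to sign; dividing by the one on
    [step_set v j j] removes the scalar that depends on the basis chosen in
    dimension [j.+1]. *)
Definition normal_form v F : 'M[K]_k := \matrix_(a, b)
  let i := (v^-1)%g a in let j := (v^-1)%g b in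
  if (j <= i)%N then
    step_sign v j j / step_sign v i j *
    (plucker F (step_set v i j) / plucker F (step_set v j j))
  else 0.

Lemma plucker_step v (i j : 'I_k) x :
  (j <= i)%N -> unitriangular (chart_order v) x ->
  plucker (flag_of (x *m pmx K v)) (step_set v i j) =
  basis_det (x *m pmx K v) (inord j.+1) * (step_sign v i j * x (v i) (v j)).
Proof.
move=> ji ux; have [_ Ux] := unitriangular_tri (chart_order_rank v) ux.
rewrite plucker_flag_of ?unitmx_mul ?Ux ?pmx_unit // card_step //.
by rewrite minor_unitriangular.
Qed.

Lemma normal_form_flag_of v x : unitriangular (chart_order v) x ->
  normal_form v (flag_of (x *m pmx K v)) = x.
Proof.
move=> ux; have [_ Ux] := unitriangular_tri (chart_order_rank v) ux.
have uxV : x *m pmx K v \in unitmx by rewrite unitmx_mul Ux pmx_unit.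
apply/matrixP => a b; rewrite mxE /=.
case: leqP => [ji|ij]; last by case: ux => -> //; rewrite /chart_order -ltnNge.
rewrite !plucker_step // !permKV (proj2 ux) mulr1.
have := step_sign_neq0 v ji; have := step_sign_neq0 v (leqnn ((v^-1)%g b)).
have := basis_det_neq0 (inord ((v^-1)%g b).+1) uxV.
move: (basis_det _ _) (step_sign _ _ _) (step_sign _ _ _) => c e e' c0 e0 e'0.
by field; rewrite c0 e0 e'0.
Qed.

(** The Plücker coordinates on the sets [step_set v j j] are the leading principal
    minors of [invmx (pmx K v) *m M], up to non-zero scalars, and their
    non-vanishing is the condition for an LU factorization. *)
Lemma chart_flagP v M : M \in unitmx ->
  (exists2 x, unitriangular (chart_order v) x & flag_of M = flag_of (x *m pmx K v))
  <-> (forall j, plucker (flag_of M) (step_set v j j) != 0).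
Proof.
move=> uM; split=> [[x ux ->] j|p0].
  have [_ Ux] := unitriangular_tri (chart_order_rank v) ux.
  rewrite plucker_step // !mulf_neq0 ?step_sign_neq0 //.
    by rewrite basis_det_neq0 // unitmx_mul Ux pmx_unit.
  by rewrite (proj2 ux) oner_neq0.
apply: lu_flag_of => // a; rewrite unitmxE unitfE; apply/det0P => -[z z0 zB].
have zge (b : 'I_k) : (a <= b)%N -> z 0 b = 0.
  move=> ab; have /rowP/(_ b) := zB; rewrite !mxE (bigD1 b) //= big1 ?addr0.
    by rewrite mxE /leading_order [(b < a)%N]ltnNge ab andbF eqxx mulr1.
  move=> c cb; rewrite mxE /leading_order [(b < a)%N]ltnNge ab andbF.
  by rewrite (negPf cb) mulr0.
(* A kernel vector of the padded block is supported before [a], and restricts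
   to a kernel vector of the leading submatrix of size [a], which has a non-zero
   determinant. *)
have [b0 zb0] : exists b, z 0 b != 0 by apply/rV0Pn.
have b0a : (b0 < a)%N by rewrite ltnNge; apply: contraNN zb0 => /zge->.
pose j : 'I_k := Ordinal (leq_ltn_trans (leq_pred a) (ltn_ord a)).
have ja : j.+1 = a by rewrite /= prednK // (leq_ltn_trans _ b0a).
have := p0 j; rewrite plucker_flag_of // mulf_eq0 negb_or => /andP[_].
have [e e0 ->] := minor_step v (leqnn j); rewrite mulf_eq0 negb_or => /andP[_].
set A := step_set v j j; have Aa : #|A| = a by rewrite card_step.
apply/negP; rewrite negbK; apply/det0P.
exists (\row_c z 0 (widen_ord (card_le A) c)).
  apply: contra_neq zb0 => /rowP z'0.
  have b0A : (b0 < #|A|)%N by rewrite Aa.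
  have := z'0 (Ordinal b0A); rewrite !mxE => <-.
  by congr (z 0 _); apply: val_inj.
apply/rowP => b; rewrite !mxE.
have /rowP/(_ (widen_ord (card_le A) b)) := zB; rewrite !mxE => e1.
rewrite -[RHS]e1 [RHS](bigID (fun l : 'I_k => (l < #|A|)%N)) /=.
rewrite [X in _ = _ + X]big1 ?addr0; last first.
  by move=> l; rewrite -leqNgt => Al; rewrite zge ?mul0r // -Aa.
rewrite (big_ord_narrow (card_le A)) /=; apply: eq_bigr => l _.
have [la ba] : (l < a)%N /\ (b < a)%N by rewrite -Aa !ltn_ord.
rewrite [block _ _ _ _ _]mxE /leading_order /= la ba; congr (_ * _).
  by rewrite mxE.
rewrite -[in LHS](mulKVmx (pmx_unit K v) M) mxE /step_seq.
suff -> : (if (l < j)%N then v (widen_ord (card_le A) l) else v j) =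
          v (widen_ord (card_le A) l) by rewrite pmx_mull.
move: la; rewrite -ja ltnS leq_eqVlt => /orP[/eqP lj|-> //].
by rewrite lj ltnn; congr (v _); apply: val_inj.
Qed.

End Minors.

(** * Splitting the chart *)

Section MatrixFractions.
Variables (K : fieldType) (k : nat) (S : projSpace K) (X : set S).
Implicit Types (M N : S -> 'M[K]_k).

Lemma fraction_minor M (A : {set 'I_k}) :
  (forall a b, fraction_on X (fun s => M s a b)) ->
  fraction_on X (fun s => minor (M s) A).
Proof.
move=> hM; apply: fraction_det => a b.
apply: fraction_eq (hM (enum_val a) (widen_ord (card_le A) b)) => s _.
by rewrite mxE.
Qed.

Lemma fraction_residue p t M :
  reflexive p -> ranked p -> (forall s, X s -> unitriangular p (M s)) ->
  (forall a b, fraction_on X (fun s => M s a b)) ->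
  forall a b, fraction_on X (fun s => residue p t (M s) a b).
Proof.
move=> p_refl p_rank uM hM; apply: fraction_mulmx => // a c.
apply: (@fraction_eq _ _ _ (fun s => if a == c then 1 else
    if strict_part p t a c then - \sum_(b | strict_part p t a b)
      M s a b * invmx (block (strict_part p t) (M s) a) b c else 0)).
  by move=> s _; rewrite mxE.
case: (a == c); first exact: fraction_cst.
case: (strict_part p t a c); last exact: fraction_cst.
apply: fractionN; apply: fraction_sum => b _; apply: fractionM => //.
apply: fraction_invmx => [s Xs|i j].
  exact: block_unit p_refl p_rank (unitriangular_tri p_rank (uM s Xs)).
apply: (@fraction_eq _ _ _ (fun s =>
    if strict_part p t a i && strict_part p t a j then M s i j else (i == j)%:R)).
  by move=> s _; rewrite mxE.
by case: (_ && _); [apply: hM | apply: fraction_cst].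
Qed.

Lemma fraction_mul_pmx v M : (forall a b, fraction_on X (fun s => M s a b)) ->
  forall a b, fraction_on X (fun s => (M s *m pmx K v) a b).
Proof.
by move=> hM a b; apply: fraction_eq (hM a (v b)) => s _; rewrite pmx_mulr.
Qed.

(** The parameter [coord] allows for flags that are components of points of a
    product. *)
Lemma fraction_normal_form (v : 'S_k) (F : S -> flag K k)
    (coord : {set 'I_k} -> pcoord S) :
  (forall A s, hcoord s (coord A) = plucker (F s) A) ->
  (forall A B : {set 'I_k}, #|A| = #|B| ->
     pfactor (coord A) = pfactor (coord B)) ->
  (forall s, X s -> exists2 x, unitriangular (chart_order v) x &
     F s = flag_of (x *m pmx K v)) ->
  forall a b, fraction_on X (fun s => normal_form v (F s) a b).
Proof.
move=> hcE pfE hF a b; set i := (v^-1)%g a; set j := (v^-1)%g b.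
apply: (@fraction_eq _ _ _ (fun s => if (j <= i)%N then
    step_sign K v j j / step_sign K v i j *
    (hcoord s (coord (step_set v i j)) / hcoord s (coord (step_set v j j)))
  else 0)).
  by move=> s _; rewrite mxE !hcE.
case: (leqP j i) => ji; last exact: fraction_cst.
apply: fractionM; first exact: fraction_cst.
apply: fraction_ratio => [|s Xs]; first by apply: pfE; rewrite !card_step.
rewrite hcE; have [x ux Fx] := hF s Xs; rewrite Fx.
have [_ Ux] := unitriangular_tri (chart_order_rank v) ux.
have uxV : x *m pmx K v \in unitmx by rewrite unitmx_mul Ux pmx_unit.
by apply: (proj1 (chart_flagP v uxV)); exists x.
Qed.

End MatrixFractions.

Section Splitting.
Variables (K : fieldType) (k : nat) (u v w : 'S_k).
Implicit Types (x m n : 'M[K]_k) (F : flag K k).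
Notation V := (pmx K v).
Notation p := (chart_order v).
Notation nf := (normal_form v).

Let p_refl : reflexive p := @chart_order_refl _ v.
Let p_trans : transitive p := @chart_order_trans _ v.
Let p_rank : ranked p := @chart_order_rank _ v.
Let le_refl : reflexive (@leo k) := @leo_refl k.
Let le_trans : transitive (@leo k) := @leo_trans k.
Let le_rank : ranked (@leo k) := @leo_rank k.
Let ge_refl : reflexive (@geo k) := @geo_refl k.
Let ge_trans : transitive (@geo k) := @geo_trans k.
Let ge_rank : ranked (@geo k) := @geo_rank k.

Notation uniN := (@unitriangular K k p).
Notation uniU := (@unitriangular K k (meet_rel p (@leo k))).
Notation uniL := (@unitriangular K k (meet_rel p (@geo k))).

Let leo_geo_total (a b : 'I_k) : leo a b || geo a b.
Proof. exact: leq_total. Qed.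
Let geo_leo_total (a b : 'I_k) : geo a b || leo a b.
Proof. exact: leq_total. Qed.
Let leo_geo_asym (a b : 'I_k) : leo a b -> geo a b -> a = b.
Proof. by move=> ab ba; apply/val_inj/anti_leq/andP. Qed.
Let geo_leo_asym (a b : 'I_k) : geo a b -> leo a b -> a = b.
Proof. by move=> ab ba; apply/val_inj/anti_leq/andP. Qed.

Definition upper_factor x := residue p (@geo k) x.
Definition lower_factor x := residue p (@leo k) x.

Lemma uniU_N m : uniU m -> uniN m.
Proof. exact: (unitriangular_sub (@meet_subl _ _ _)). Qed.
Lemma uniL_N n : uniL n -> uniN n.
Proof. exact: (unitriangular_sub (@meet_subl _ _ _)). Qed.

Lemma uniU_upper m : uniU m -> upper m.
Proof.
by move/(unitriangular_sub (@meet_subr _ _ _))/(unitriangular_tri le_rank).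
Qed.
Lemma uniL_lower n : uniL n -> lower n.
Proof.
by move/(unitriangular_sub (@meet_subr _ _ _))/(unitriangular_tri ge_rank).
Qed.

Lemma uniN_unit x : uniN x -> x \in unitmx.
Proof. by case/(unitriangular_tri p_rank). Qed.

Lemma uniN_V x : uniN x -> uniN (invmx x).
Proof. exact: (unitriangularV p_refl p_trans p_rank). Qed.

Lemma uniN_M x y : uniN x -> uniN y -> uniN (x *m y).
Proof. exact: (unitriangularM p_trans p_rank). Qed.

Lemma upper_factor_uni x : uniN x -> uniU (upper_factor x).
Proof. by move=> ux; apply: residue_uni. Qed.

Lemma lower_factor_uni x : uniN x -> uniL (lower_factor x).
Proof. by move=> ux; apply: residue_uni. Qed.

Lemma upper_lowerE x : uniN x ->
  exists2 n, uniU n & x = n *m lower_factor x.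
Proof. by move=> ux; apply: residueE. Qed.

Lemma lower_upperE x : uniN x ->
  exists2 n, uniL n & x = n *m upper_factor x.
Proof. by move=> ux; apply: residueE. Qed.

Lemma lower_factorM m n : uniU m -> uniL n -> lower_factor (m *m n) = n.
Proof.
by move=> um un; apply: (residue_unique p_refl p_trans p_rank _ _ ge_refl).
Qed.

Lemma upper_factorM n m : uniL n -> uniU m -> upper_factor (n *m m) = m.
Proof.
by move=> un um; apply: (residue_unique p_refl p_trans p_rank _ _ le_refl).
Qed.

Lemma unitV_V x : uniN x -> x *m V \in unitmx.
Proof. by move=> /uniN_unit ux; rewrite unitmx_mul ux pmx_unit. Qed.

Lemma chart_param F : richardson_chart K u v w F <->
  exists x, [/\ uniN x, F = flag_of (x *m V), in_cell w (x *m V) &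
                in_opposite_cell u (x *m V)].
Proof.
split=> [[RF cF]|[x [ux -> cx ox]]].
  have [M uM FM] := richardson_flagP RF; rewrite FM in RF cF *.
  have [x ux Fx] := in_chart_flag_of uM (proj1 (in_chart_rel _ uM) cF).
  rewrite Fx in RF *; exists x.
  by have [] := proj1 (richardson_flag_of _ _ (unitV_V ux)) RF.
split; first exact/(richardson_flag_of _ _ (unitV_V ux)).
exact/(in_chart_rel _ (unitV_V ux))/in_chart_unitriangular.
Qed.

(** The upper triangular factors in the cell of [v] are normalized by
    [cell_flag_of]; only the condition of the opposite cell of [u] remains. *)
Lemma richardson_lower_param F : richardson K u v F <->
  exists m, [/\ uniU m, F = flag_of (m *m V) & in_opposite_cell u (m *m V)].
Proof.
split=> [RF|[m [um -> om]]].
  have [M uM FM] := richardson_flagP RF; rewrite FM in RF *.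
  have [[b [b' [ub ub' e]]] _] := proj1 (richardson_flag_of _ _ uM) RF.
  have [m um Fm] := cell_flag_of v le_refl le_trans le_rank ub ub'.
  rewrite e Fm in RF *; exists m.
  by have [] := proj1 (richardson_flag_of _ _ (unitV_V (uniU_N um))) RF.
apply/(richardson_flag_of _ _ (unitV_V (uniU_N um))); split=> //.
exists m, 1%:M; split; [exact: uniU_upper | exact: upper1 | by rewrite mulmx1].
Qed.

Lemma richardson_upper_param F : richardson K v w F <->
  exists n, [/\ uniL n, F = flag_of (n *m V) & in_cell w (n *m V)].
Proof.
split=> [RF|[n [un -> cn]]].
  have [M uM FM] := richardson_flagP RF; rewrite FM in RF *.
  have [_ [c [b [lc ub e]]]] := proj1 (richardson_flag_of _ _ uM) RF.
  have [n un Fn] := cell_flag_of v ge_refl ge_trans ge_rank lc ub.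
  rewrite e Fn in RF *; exists n.
  by have [] := proj1 (richardson_flag_of _ _ (unitV_V (uniL_N un))) RF.
apply/(richardson_flag_of _ _ (unitV_V (uniL_N un))); split=> //.
exists n, 1%:M; split; [exact: uniL_lower | exact: upper1 | by rewrite mulmx1].
Qed.

Definition split_flag F : flag K k * flag K k :=
  (flag_of (upper_factor (nf F) *m V), flag_of (lower_factor (nf F) *m V)).

(** If [m] and [n] are the last factors of [x = n' n = m' m], then
    [m *m invmx n = invmx m' *m n'], so that [n'] is recovered as an upper factor. *)
Definition glue_mx m n := upper_factor (m *m invmx n) *m n.

Definition glue_flag (F : flag K k * flag K k) : flag K k :=
  flag_of (glue_mx (nf F.1) (nf F.2) *m V).

Lemma glue_flag_of m n : uniN m -> uniN n ->
  glue_flag (flag_of (m *m V), flag_of (n *m V)) = flag_of (glue_mx m n *m V).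
Proof.
move=> um un; rewrite /glue_flag [fst _]/= [snd _]/=.
by rewrite (normal_form_flag_of um) (normal_form_flag_of un).
Qed.

Lemma split_flag_of x : uniN x -> split_flag (flag_of (x *m V)) =
  (flag_of (upper_factor x *m V), flag_of (lower_factor x *m V)).
Proof. by move=> ux; rewrite /split_flag normal_form_flag_of. Qed.

Lemma glue_mx_uni m n : uniN m -> uniN n -> uniN (glue_mx m n).
Proof.
move=> um un; apply: uniN_M => //; apply/uniU_N/upper_factor_uni.
exact/uniN_M/uniN_V.
Qed.

Lemma lower_factor_glue m n : uniU m -> uniL n -> lower_factor (glue_mx m n) = n.
Proof.
move=> um un; apply: lower_factorM => //; apply: upper_factor_uni.
by apply: uniN_M (uniU_N um) _; apply/uniN_V/uniL_N.
Qed.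

Lemma glueE m n : uniU m -> uniL n -> exists2 c, uniL c & glue_mx m n = c *m m.
Proof.
move=> um un; have [uNm uNn] := (uniU_N um, uniL_N un).
have [c uc e] := lower_upperE (uniN_M uNm (uniN_V uNn)).
have Uc := uniN_unit (uniL_N uc).
exists (invmx c).
  by apply: unitriangularV uc; [apply: meet_refl|apply: meet_trans|apply: meet_rank].
rewrite /glue_mx -[upper_factor _](mulKmx Uc) -e -mulmxA mulmxKV //.
exact: uniN_unit.
Qed.

Lemma upper_factor_glue m n : uniU m -> uniL n -> upper_factor (glue_mx m n) = m.
Proof. by move=> um un; have [c uc ->] := glueE um un; apply: upper_factorM. Qed.

Lemma glue_factors x : uniN x -> glue_mx (upper_factor x) (lower_factor x) = x.
Proof.
move=> ux; have [n un xn] := upper_lowerE ux; have [c uc xc] := lower_upperE ux.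
have um := uniU_N (upper_factor_uni ux); have ul := uniL_N (lower_factor_uni ux).
rewrite /glue_mx [RHS]xn; congr (_ *m _).
have -> : upper_factor x *m invmx (lower_factor x) = invmx c *m n.
  have e : c *m upper_factor x = n *m lower_factor x by rewrite -xc -xn.
  rewrite -[upper_factor x](mulKmx (uniN_unit (uniL_N uc))) e mulmxA mulmxK //.
  exact: uniN_unit.
apply: upper_factorM => //.
by apply: unitriangularV uc; [apply: meet_refl|apply: meet_trans|apply: meet_rank].
Qed.

Lemma split_in F : richardson_chart K u v w F ->
  richardson_prod K u v w (split_flag F).
Proof.
move=> /chart_param[x [ux -> cx ox]]; rewrite split_flag_of //.
have uU := upper_factor_uni ux; have uL := lower_factor_uni ux.
split=> /=.
  apply/richardson_lower_param; exists (upper_factor x); split=> //.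
  have [c uc xc] := lower_upperE ux; move: ox; rewrite xc -mulmxA -xc.
  by move/(in_opposite_cell_mull _ _ (uniL_lower uc)).
apply/richardson_upper_param; exists (lower_factor x); split=> //.
have [n un xn] := upper_lowerE ux; move: cx; rewrite xn -mulmxA -xn.
by move/(in_cell_mull _ _ (uniU_upper un)).
Qed.

Lemma glue_in (G : flag K k * flag K k) : richardson_prod K u v w G ->
  richardson_chart K u v w (glue_flag G).
Proof.
case: G => F1 F2 [/richardson_lower_param[m [um /= -> om]]].
move=> /richardson_upper_param[n [un /= -> cn]]; apply/chart_param.
have [uNm uNn] := (uniU_N um, uniL_N un).
rewrite glue_flag_of //; exists (glue_mx m n).
split=> //; first exact: glue_mx_uni.
  rewrite /glue_mx -mulmxA; apply/in_cell_mull => //.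
  exact/uniU_upper/upper_factor_uni/uniN_M/uniN_V.
have [c uc ->] := glueE um un; rewrite -mulmxA.
by apply/in_opposite_cell_mull => //; apply: uniL_lower.
Qed.

Lemma split_flagK F : richardson_chart K u v w F -> glue_flag (split_flag F) = F.
Proof.
move=> /chart_param[x [ux -> _ _]].
have uU := uniU_N (upper_factor_uni ux).
have uL := uniL_N (lower_factor_uni ux).
by rewrite (split_flag_of ux) (glue_flag_of uU uL) glue_factors.
Qed.

Lemma glue_flagK (G : flag K k * flag K k) :
  richardson_prod K u v w G -> split_flag (glue_flag G) = G.
Proof.
case: G => F1 F2 [/richardson_lower_param[m [um /= -> _]]].
move=> /richardson_upper_param[n [un /= -> _]].
have [uNm uNn] := (uniU_N um, uniL_N un).
rewrite (glue_flag_of uNm uNn) (split_flag_of (glue_mx_uni uNm uNn)).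
by rewrite upper_factor_glue ?lower_factor_glue.
Qed.

Let chart_nf F : richardson_chart K u v w F -> uniN (nf F).
Proof. by move=> /chart_param[x [ux -> _ _]]; rewrite normal_form_flag_of. Qed.

Lemma split_morphism :
  morphism_on (richardson_chart K u v w) (richardson_prod K u v w) split_flag.
Proof.
have nf_frac := @fraction_normal_form K k (flagSpace K k)
  (richardson_chart K u v w) v id id (fun _ _ => erefl).
apply: (@morphism_criterion K (flagSpace K k)
  (prodSpace (flagSpace K k) (flagSpace K k))
  _ _ _
  (fun F i => match i with
     | inl i => basis_det (upper_factor (nf F) *m V) i
     | inr i => basis_det (lower_factor (nf F) *m V) i end)
  (fun j F => match j with
     | inl A => minor (upper_factor (nf F) *m V) A
     | inr A => minor (lower_factor (nf F) *m V) A end)).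
- move=> F /chart_nf uF [] i; apply/basis_det_neq0/unitV_V.
    exact/uniU_N/upper_factor_uni.
  exact/uniL_N/lower_factor_uni.
- move=> F /chart_nf uF [] A; apply/plucker_flag_of/unitV_V.
    exact/uniU_N/upper_factor_uni.
  exact/uniL_N/lower_factor_uni.
- have nfF : forall a b, fraction_on (V := flagSpace K k)
      (richardson_chart K u v w) (fun F => nf F a b).
    apply: nf_frac => [A B /= -> //|F /chart_param[x [ux -> _ _]]].
    by exists x.
  by move=> [] A; apply/fraction_minor/fraction_mul_pmx/fraction_residue.
- exact: split_in.
Qed.

Lemma glue_morphism :
  morphism_on (richardson_prod K u v w) (richardson_chart K u v w) glue_flag.
Proof.
pose W := prodSpace (flagSpace K k) (flagSpace K k).
have N1 (G : W) : richardson_prod K u v w G -> uniN (nf G.1).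
  move=> [/richardson_lower_param[m [/uniU_N um -> _]] _].
  by rewrite normal_form_flag_of.
have N2 (G : W) : richardson_prod K u v w G -> uniN (nf G.2).
  move=> [_ /richardson_upper_param[m [/uniL_N um -> _]]].
  by rewrite normal_form_flag_of.
apply: (@morphism_criterion K W (flagSpace K k)
  (richardson_prod K u v w) (richardson_chart K u v w) glue_flag
  (fun G : W => basis_det (glue_mx (nf G.1) (nf G.2) *m V))
  (fun A (G : W) => minor (glue_mx (nf G.1) (nf G.2) *m V) A)).
- move=> G RG i; apply/basis_det_neq0/unitV_V/glue_mx_uni; [exact: N1|exact: N2].
- move=> G RG A; apply/plucker_flag_of/unitV_V/glue_mx_uni; [exact: N1|exact: N2].
- have F1 : forall a b, fraction_on (V := W)
      (richardson_prod K u v w) (fun G : W => nf G.1 a b).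
    apply: (@fraction_normal_form _ _ W _ v fst inl) => [//|A B /= -> //|F].
    move=> [/richardson_lower_param[m [/uniU_N um -> _]] _].
    by exists m.
  have F2 : forall a b, fraction_on (V := W)
      (richardson_prod K u v w) (fun G : W => nf G.2 a b).
    apply: (@fraction_normal_form _ _ W _ v snd inr) => [//|A B /= -> //|F].
    move=> [_ /richardson_upper_param[m [/uniL_N um -> _]]].
    by exists m.
  move=> A; apply/fraction_minor/fraction_mul_pmx/fraction_mulmx => //.
  apply: fraction_residue => // [G RG|].
    by apply: uniN_M (N1 G RG) _; apply/uniN_V/N2.
  apply: fraction_mulmx => //; apply: fraction_invmx => // G RG.
  exact/uniN_unit/N2.
- exact: glue_in.
Qed.

Lemma chart_isomorphic :
  isomorphic (richardson_chart K u v w) (richardson_prod K u v w).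
Proof.
exists split_flag, glue_flag; split.
- exact: split_morphism.
- exact: glue_morphism.
- exact: split_flagK.
- exact: glue_flagK.
Qed.

Lemma chart_principal :
  principal_open (richardson K u w) (richardson_chart K u v w).
Proof.
have nonzero_w F j : richardson K u w F -> plucker F (step_set w j j) != 0.
  move=> RF; have [M uM FM] := richardson_flagP RF; rewrite FM in RF *.
  have [[b [b' [ub ub' e]]] _] := proj1 (richardson_flag_of _ _ uM) RF.
  have [n un Fn] := cell_flag_of w le_refl le_trans le_rank ub ub'.
  move: j; apply/(chart_flagP _ uM); exists n; last by rewrite e.
  exact: unitriangular_sub (@meet_subl _ _ _) un.
exists (fun F : flagSpace K k => \prod_(j < k)
   (hcoord F (step_set v j j) / hcoord F (step_set w j j))); split.
  apply/fraction_regular/fraction_prod => j _.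
  apply: fraction_ratio => [|F RF]; first by rewrite /= !card_step.
  exact: nonzero_w.
apply/seteqP; split=> F.
  move=> UF; have [RF _] := UF; split=> //; apply/prodf_neq0 => j _.
  rewrite mulf_neq0 ?invr_eq0 ?nonzero_w //.
  have /chart_param[x [ux -> _ _]] := UF; move: j.
  by apply/(chart_flagP _ (unitV_V ux)); exists x.
move=> [RF /prodf_neq0 p0]; split=> //.
have [M uM FM] := richardson_flagP RF; rewrite FM in RF p0 *.
have [|x ux ->] := proj2 (chart_flagP v uM).
  by move=> j; have := p0 j isT; rewrite mulf_eq0 negb_or => /andP[].
exact/(in_chart_rel _ (unitV_V ux))/in_chart_unitriangular.
Qed.

End Splitting.

Theorem theorem1p5 (R : realType) (k : nat) (u v w : 'S_k)
    (huv : bruhat u v) (hvw : bruhat v w) :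
  principal_open (richardson R[i] u w) (richardson_chart R[i] u v w) /\
  isomorphic (richardson_chart R[i] u v w) (richardson_prod R[i] u v w).
Proof. by split; [apply: chart_principal | apply: chart_isomorphic]. Qed.
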